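(* (i) Let $\mathcal H$ be a complex Hilbert space and let $M_A, M_B\subset B(\mathcal H)$ be commuting factors on $\mathcal H$ (i.e. $ab=ba$ for all $a\in M_A$, $b\in M_B$). Then $(M_A,M_B)$ satisfies Haag duality if and only if it has the Uhlmann property, and if $(M_A,M_B)$ satisfies Haag duality, then it satisfies local tomography. (ii) Local tomography does not imply Haag duality, nor the Uhlmann property: there exist a Hilbert space $\mathcal H$ and commuting factors $M_A,M_B\subset B(\mathcal H)$ such that $(M_A,M_B)$ satisfies local tomography, but satisfies neither Haag duality nor the Uhlmann property.
   Context: A von Neumann algebra on $\mathcal H$ is a unital *-subalgebra $M\subset B(\mathcal H)$ (containing the identity operator of $\mathcal H$) with $M=M''$, where $M' = \{x\in B(\mathcal H) : xy=yx \ \forall y\in M\}$ denotes the commutant. A factor is a von Neumann algebra $M$ with $M\cap M'=\mathbb C 1$. Let $M_A,M_B$ be commuting von Neumann algebras on $\mathcal H$. Local tomography: the pair $(M_A,M_B)$ satisfies local tomography if every density operator $\rho$ on $\mathcal H$ is uniquely determined (among density operators on $\mathcal H$) by the correlation function $(a,b)\mapsto \operatorname{tr}(\rho ab)$, $a\in M_A$, $b\in M_B$. Equivalently, $M_A\vee M_B = B(\mathcal H)$, where $M_A\vee M_B=(M_A\cup M_B)''$ is the von Neumann algebra generated by $M_A$ and $M_B$. Haag duality: the pair $(M_A,M_B)$ satisfies Haag duality if $M_B=M_A'$ (equivalently, $M_A=M_B'$). Uhlmann property: the pair $(M_A,M_B)$ has the Uhlmann property if, for any two unit vectors $\Phi,\Psi\in\mathcal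 H$, the condition $\langle \Psi,a\Psi\rangle=\langle\Phi,a\Phi\rangle$ for all $a\in M_A$ implies that for every $\varepsilon>0$ there exists a unitary $u\in M_B$ with $|\langle\Psi,u\Phi\rangle|\ge 1-\varepsilon$. *)

(* Defs.v *)
From HB Require Import structures.
From mathcomp Require Import all_boot all_order all_algebra sesquilinear.
From mathcomp Require Import finmap complex.
From mathcomp Require Import boolp classical_sets functions reals.
From mathcomp Require Import topology normedtype.
From mathcomp.analysis.showcase Require Import summability.

Set Implicit Arguments.
Unset Strict Implicit.
Unset Printing Implicit Defensive.

Import Order.TTheory GRing.Theory Num.Theory numFieldNormedType.Exports.

Local Open Scope classical_set_scope.
Local Open Scope ring_scope.
Local Open Scope complex_scope.

(* A complex Hilbert space, not assumed separable or nonzero.  Completeness is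
   that of the underlying normed module, whose norm is the inner-product norm. *)
Record hilbertType (R : realType) := Hilbert {
  hilbert_sort :> completeNormedModType R[i] ;
  hilbert_dot : {dot hilbert_sort for Num.conj} ;
  hilbert_normE : forall x : hilbert_sort, hilbert_dot x x = `|x| ^+ 2 }.

Section Operators.
Variables (R : realType) (H : hilbertType R).
Implicit Types (x y : H) (a b u : H -> H) (S M : set (H -> H)).

(* The form [hilbert_dot] is linear on the left; with the swap, [inner x y] is
   antilinear in x and linear in y. *)
Definition inner x y : R[i] := hilbert_dot H y x.

Local Notation "<< x , y >>" := (inner x y).

Definition bounded_operators : set (H -> H) :=
  [set a | linear a /\ exists C : R, forall x, `|a x| <= C%:C * `|x|].

(* [b] is the adjoint of [a]. *)
Definition is_adjoint a b := forall x y, << x, a y >> = << b x, y >>.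

Definition unitary_operator u :=
  exists v, [/\ is_adjoint u v, u \o v = id & v \o u = id].

Definition commutant S : set (H -> H) :=
  [set a | bounded_operators a /\ forall b, S b -> a \o b = b \o a].

Record star_subalgebra M : Prop := StarSubalgebra {
  star_sub : M `<=` bounded_operators ;
  star_unit : M id ;
  star_add : forall a b, M a -> M b -> M (a \+ b) ;
  star_scale : forall (c : R[i]) a, M a -> M (c \*: a) ;
  star_mul : forall a b, M a -> M b -> M (a \o b) ;
  star_adj : forall a, M a -> exists2 b, M b & is_adjoint a b }.

Definition von_neumann_algebra M :=
  star_subalgebra M /\ M = commutant (commutant M).

Definition scalar_operators : set (H -> H) :=
  [set a | exists c : R[i], a = c \*: id].

Definition vn_factor M :=
  von_neumann_algebra M /\ M `&` commutant M = scalar_operators.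

Definition commuting_operators (S1 S2 : set (H -> H)) :=
  forall a b, S1 a -> S2 b -> a \o b = b \o a.

Definition orthonormal_basis (I : choiceType) (e : I -> H) :=
  (forall i j, << e i, e j >> = (i == j)%:R) /\
  (forall x, (forall i, << e i, x >> = 0) -> x = 0).

(* Unconditional convergence: limit along the finite subsets of [I]. *)
Definition has_sum (I : choiceType) (f : I -> R[i]) (s : R[i]) :=
  partial_sum f @ totally --> (s : R[i]^o).

(* [T] is trace class with trace [t]: a bounded operator is trace class exactly
   when its diagonal is summable along every orthonormal basis, and then the
   sum does not depend on the basis. *)
Definition has_trace (T : H -> H) (t : R[i]) :=
  forall (I : choiceType) (e : I -> H), orthonormal_basis e ->
    has_sum (fun i => << e i, T (e i) >>) t.

(* The value is 0 when [T] is not trace class. *)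
Definition tr (T : H -> H) : R[i] := xget 0 (has_trace T).

(* In [R[i]], [0 <= z] includes that z is real. *)
Definition positive_operator (a : H -> H) := forall x, 0 <= << x, a x >>.

Definition density_operator (rho : H -> H) :=
  [/\ bounded_operators rho, positive_operator rho & has_trace rho 1].

Definition local_tomography (MA MB : set (H -> H)) :=
  forall rho sigma, density_operator rho -> density_operator sigma ->
    (forall a b, MA a -> MB b ->
       tr (rho \o a \o b) = tr (sigma \o a \o b)) ->
    rho = sigma.

Definition haag_duality (MA MB : set (H -> H)) := MB = commutant MA.

Definition uhlmann_property (MA MB : set (H -> H)) :=
  forall Phi Psi : H, `|Phi| = 1 -> `|Psi| = 1 ->
    (forall a, MA a -> << Psi, a Psi >> = << Phi, a Phi >>) ->
    forall eps : R, 0 < eps ->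
      exists u, [/\ MB u, unitary_operator u &
                   1 - eps%:C <= `| << Psi, u Phi >> |].

End Operators.

(* Main.v *)
Require Import Defs.
From HB Require Import structures.
From mathcomp Require Import all_boot all_order all_algebra sesquilinear.
From mathcomp Require Import finmap complex.
From mathcomp Require Import boolp classical_sets functions reals.
From mathcomp Require Import topology normedtype.
From mathcomp.analysis.showcase Require Import summability.
From mathcomp Require Import zify ring lra.

(** A contraction v in M_A' carrying Phi to Psi exists as soon as Phi and Psi
    induce the same state on M_A (close up a Phi |-> a Psi).  The supremum of
    Re <Psi, u Phi> over the unitaries u of M_A' dominates Re <Psi, v Phi>
    because unitaries are plentiful: sqrt (1 - k^2) + i k is one for each
    self-adjoint contraction k.  This gives Haag => Uhlmann without comparing
    projections.

    Conversely, a unitary v of M_A' does not change the state on M_A, so under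
    the Uhlmann property v Phi is a limit of phases times u Phi with u in M_B.
    Hence v and the identity induce the same quadratic forms on M_B', so v
    commutes with M_B' and lies in M_B'' = M_B.

    If (M_A u M_B)' is trivial, so is local tomography: tr (rho x) - tr (sigma x)
    is a matrix coefficient <Om', (x (x) 1) Om> of an amplification, and the
    projection onto the complement of the span of (a b (x) 1) Om has scalar
    matrix entries, so this subspace is invariant under all bounded operators.

    For the counterexample let G be the group of affine maps x |-> 2^n x + b,
    D the subgroup with n even, M_A = L(G)' and M_B = L(D) on l2(G).  Every
    nontrivial element of G has infinitely many conjugates under D, so that
    L(D)' and L(G) have only scalars in common, while L(D) <> L(G). *)

Set Implicit Arguments.
Unset Strict Implicit.
Unset Printing Implicit Defensive.

Import Order.TTheory GRing.Theory Num.Theory numFieldNormedType.Exports.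

Local Open Scope classical_set_scope.
Local Open Scope ring_scope.
Local Open Scope complex_scope.

Local Notation Re := complex.Re.
Local Notation Im := complex.Im.
Local Notation cj := conjc.
Local Notation ci := (Complex 0 1).

(** * Moduli and inner products *)

(** For Haag => Uhlmann the contraction need not be close to any unitary: only the functional Re
    <Psi, . Phi> has to be controlled. Moving a nearly optimal unitary into Phi makes it nearly
    maximal at the identity, hence nearly real on self-adjoint operators, so that the two
    self-adjoint parts of the contraction can be estimated separately.

    Since [tr] refers to all orthonormal bases, using it means proving convergence to one value
    along each of them. Polarization turns such a sum into four sums of squared norms, where double
    series of nonnegative terms may be exchanged.

    For tomography, rho and sigma are replaced by their square roots because the vectors s f_j are
    then square summable, which makes a trace functional a vector functional on a direct sum of
    copies of H.

    In the example M_A' is the bicommutant of the left shifts of G, and L(D) is a proper subfactor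
    of it with trivial relative commutant: conjugation by dilations spreads translations,
    conjugation by translations spreads everything else, and D retains enough of both. Uhlmann fails
    there because Haag duality does. *)

Section ComplexModulus.
Variable R : realType.
Implicit Types z w : R[i].

(** The norms of [R[i]] and of [H] take values in [R[i]]. The real versions [cabs] and [nrm] give
    access to the total order, to suprema and to real arithmetic. *)
Definition cabs z : R := Re `|z|.

Lemma cabsE z : `|z| = (cabs z)%:C.
Proof. by rewrite /cabs RRe_real// normr_real. Qed.

Lemma cabs_ge0 z : 0 <= cabs z.
Proof. by rewrite -ler0c -cabsE normr_ge0. Qed.

Lemma cabsD z w : cabs (z + w) <= cabs z + cabs w.
Proof. by rewrite -lecR rmorphD/= -!cabsE ler_normD. Qed.

Lemma cabsM z w : cabs (z * w) = cabs z * cabs w.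
Proof. by apply: complexI; rewrite rmorphM/= -!cabsE normrM. Qed.

Lemma cabsN z : cabs (- z) = cabs z.
Proof. by rewrite /cabs normrN. Qed.

Lemma cabs0 : cabs 0 = 0.
Proof. by rewrite /cabs normr0. Qed.

Lemma cabs_eq0 z : cabs z = 0 -> z = 0.
Proof. by move=> z0; apply/eqP; rewrite -normr_eq0 cabsE z0. Qed.

Lemma cabs_real (r : R) : cabs r%:C = `|r|.
Proof. by rewrite /cabs normc_def/= expr0n/= addr0 sqrtr_sqr. Qed.

Lemma cabsi : cabs ci = 1.
Proof. by rewrite /cabs normc_def/= expr0n/= add0r expr1n sqrtr1. Qed.

Lemma cabs_conj z : cabs (cj z) = cabs z.
Proof. by rewrite /cabs normcJ. Qed.

Lemma cabs_sqr z : cabs z ^+ 2 = Re z ^+ 2 + Im z ^+ 2.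
Proof. by apply: complexI; rewrite rmorphXn/= -cabsE -add_Re2_Im2. Qed.

Lemma mul_conj z : cj z * z = (cabs z ^+ 2)%:C.
Proof. by rewrite rmorphXn/= -cabsE sqr_normc mulrC. Qed.

Lemma Re_le_cabs z : Re z <= cabs z.
Proof.
rewrite -lecR -cabsE; apply: le_trans (normc_ge_Re _).
by rewrite lecR ler_norm.
Qed.

Lemma Re_le_cabs_norm z : `|Re z| <= cabs z.
Proof. by rewrite -lecR -cabsE normc_ge_Re. Qed.

Lemma Im_le_cabs_norm z : `|Im z| <= cabs z.
Proof.
rewrite -(@ler_pXn2r _ 2)// ?nnegrE ?cabs_ge0//.
by rewrite cabs_sqr real_normK ?num_real// lerDr sqr_ge0.
Qed.

Lemma complex_eq z w : Re z = Re w -> Im z = Im w -> z = w.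
Proof. by case: z => a b; case: w => c d /= -> ->. Qed.

Lemma ReD z w : Re (z + w) = Re z + Re w. Proof. by case: z; case: w. Qed.
Lemma ImD z w : Im (z + w) = Im z + Im w. Proof. by case: z; case: w. Qed.
Lemma ReN z : Re (- z) = - Re z. Proof. by case: z. Qed.
Lemma ImN z : Im (- z) = - Im z. Proof. by case: z. Qed.
Lemma Re_mulr (r : R) z : Re (r%:C * z) = r * Re z.
Proof. by case: z => a b /=; rewrite mul0r subr0. Qed.
Lemma cj_ci : cj ci = - ci :> R[i].
Proof. by rewrite /= /GRing.opp/= oppr0. Qed.

Lemma cj_Nci : cj (- ci) = - - ci :> R[i].
Proof. by apply: complex_eq; rewrite /= ?opprK ?oppr0. Qed.

Lemma mul_ci : ci * ci = -1 :> R[i].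
Proof. by rewrite -expr2 sqr_i. Qed.

Lemma ci_neq0 : ci != 0 :> R[i].
Proof. by apply/eqP => /(congr1 (@complex.Im R))/= /eqP; rewrite oner_eq0. Qed.

End ComplexModulus.

Section InnerProduct.
Variables (R : realType) (H : hilbertType R).
Implicit Types x y z : H.

Definition nrm x : R := Re `|x|.

Lemma nrmE x : `|x| = (nrm x)%:C.
Proof.
rewrite /nrm; have /ger0_real/complex_realP[r ->] // : 0 <= `|x| by [].
Qed.

Lemma nrm_ge0 x : 0 <= nrm x.
Proof. by rewrite -ler0c -nrmE normr_ge0. Qed.

Lemma nrmD x y : nrm (x + y) <= nrm x + nrm y.
Proof. by rewrite -lecR rmorphD/= -!nrmE ler_normD. Qed.

Lemma nrmZ c x : nrm (c *: x) = cabs c * nrm x.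
Proof. by apply: complexI; rewrite rmorphM/= -!nrmE normrZ cabsE. Qed.

Lemma nrmN x : nrm (- x) = nrm x.
Proof. by rewrite /nrm normrN. Qed.

Lemma nrm0 : nrm 0 = 0.
Proof. by rewrite /nrm normr0. Qed.

Lemma nrmB x y : nrm (x - y) = nrm (y - x).
Proof. by rewrite -opprB nrmN. Qed.

Lemma nrm_eq0 x : nrm x = 0 -> x = 0.
Proof. by move=> x0; apply/eqP; rewrite -normr_eq0 nrmE x0. Qed.

Lemma nrm_tri x y z : nrm (x - z) <= nrm (x - y) + nrm (y - z).
Proof. by rewrite -{1}[x](subrK y) -addrA nrmD. Qed.

Lemma innerDr x y z : inner x (y + z) = inner x y + inner x z.
Proof. by rewrite /inner linearDl. Qed.

Lemma innerDl x y z : inner (x + y) z = inner x z + inner y z.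
Proof. by rewrite /inner linearDr. Qed.

Lemma innerZr c x y : inner x (c *: y) = c * inner x y.
Proof. by rewrite /inner linearZl_LR. Qed.

Lemma innerZl c x y : inner (c *: x) y = cj c * inner x y.
Proof. by rewrite /inner linearZr_LR. Qed.

Lemma innerNr x y : inner x (- y) = - inner x y.
Proof. by rewrite -scaleN1r innerZr mulN1r. Qed.

Lemma innerNl x y : inner (- x) y = - inner x y.
Proof. by rewrite -scaleN1r innerZl rmorphN rmorph1 mulN1r. Qed.

Lemma innerBr x y z : inner x (y - z) = inner x y - inner x z.
Proof. by rewrite innerDr innerNr. Qed.

Lemma innerBl x y z : inner (x - y) z = inner x z - inner y z.
Proof. by rewrite innerDl innerNl. Qed.

Lemma inner0r x : inner x 0 = 0.
Proof. by rewrite -(scale0r x) innerZr mul0r. Qed.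

Lemma inner0l x : inner 0 x = 0.
Proof. by rewrite -(scale0r x) innerZl rmorph0 mul0r. Qed.

Lemma innerC x y : inner x y = cj (inner y x).
Proof. by rewrite /inner hermitian_subproof expr0 mul1r. Qed.

Lemma innerxx x : inner x x = (nrm x ^+ 2)%:C.
Proof. by rewrite /inner hilbert_normE nrmE rmorphXn. Qed.

Lemma Re_innerC x y : Re (inner x y) = Re (inner y x).
Proof. by rewrite innerC; case: inner. Qed.

Lemma inner_sumr (I : Type) (r : seq I) (F : I -> H) x :
  inner x (\sum_(i <- r) F i) = \sum_(i <- r) inner x (F i).
Proof. by apply: (big_morph _ (innerDr x) (inner0r x)). Qed.

Lemma inner_suml (I : Type) (r : seq I) (F : I -> H) x :
  inner (\sum_(i <- r) F i) x = \sum_(i <- r) inner (F i) x.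
Proof. by apply: (big_morph _ (fun y z => innerDl y z x) (inner0l x)). Qed.

Lemma nrm_sqrD x y :
  nrm (x + y) ^+ 2 = nrm x ^+ 2 + nrm y ^+ 2 + 2 * Re (inner x y).
Proof.
apply: complexI; rewrite -innerxx innerDl !innerDr !innerxx (innerC y x).
set a := inner x y; apply: complex_eq; rewrite !(ReD, ImD)/=; case: a => a b /=; ring.
Qed.

Lemma nrm_sqrB x y :
  nrm (x - y) ^+ 2 = nrm x ^+ 2 + nrm y ^+ 2 - 2 * Re (inner x y).
Proof. by rewrite nrm_sqrD nrmN innerNr ReN mulrN. Qed.

Lemma parallelogram x y :
  nrm (x + y) ^+ 2 + nrm (x - y) ^+ 2 = 2 * nrm x ^+ 2 + 2 * nrm y ^+ 2.
Proof. by rewrite nrm_sqrD nrm_sqrB; ring. Qed.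

Lemma ler_of_sqr (a b : R) : 0 <= b -> a ^+ 2 <= b ^+ 2 -> a <= b.
Proof.
move=> b0 ab; have [a0|a0] := leP 0 a; last exact: le_trans (ltW a0) b0.
by rewrite -(@ler_pXn2r _ 2).
Qed.

Lemma cauchy_schwarz x y : cabs (inner x y) <= nrm x * nrm y.
Proof.
have [y0|y0] := eqVneq (nrm y) 0.
  by rewrite (nrm_eq0 y0) inner0r cabs0 nrm0 mulr0.
have ny : 0 < nrm y ^+ 2 by rewrite exprn_gt0// lt_def y0 nrm_ge0.
apply: ler_of_sqr; first by rewrite mulr_ge0 ?nrm_ge0.
(* c y is the projection of x onto the line of y; |x - c y|^2 >= 0 is the inequality. *)
set c := inner y x / (nrm y ^+ 2)%:C.
have xy : inner y x * inner x y = (cabs (inner x y) ^+ 2)%:C.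
  by rewrite (innerC y x) mul_conj.
have := sqr_ge0 (nrm (x - c *: y)).
rewrite nrm_sqrB nrmZ innerZr /c mulrAC xy exprMn cabsM -fmorphV -rmorphM/=.
rewrite cabs_real (innerC y x) cabs_conj; move: ny; rewrite [in leRHS]exprMn.
set d := cabs _; set m := nrm y ^+ 2 => m0.
rewrite ger0_norm ?invr_ge0 ?(ltW m0)//.
rewrite (_ : _ - _ = nrm x ^+ 2 - d ^+ 2 / m); last by field; apply: lt0r_neq0.
by rewrite subr_ge0 ler_pdivrMr// exprMn.
Qed.

Lemma inner_eq0 x : (forall y, inner y x = 0) -> x = 0.
Proof.
move=> /(_ x); rewrite innerxx => /(congr1 (@complex.Re R))/= /eqP.
by rewrite sqrf_eq0 => /eqP/nrm_eq0.
Qed.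

Lemma inner_inj x y : (forall z, inner z x = inner z y) -> x = y.
Proof.
move=> xy; apply/eqP; rewrite -subr_eq0; apply/eqP/inner_eq0 => z.
by rewrite innerBr xy subrr.
Qed.

Lemma polarization x y : 4%:R * inner x y =
  inner (x + y) (x + y) - inner (x - y) (x - y)
  - ci * inner (x + ci *: y) (x + ci *: y)
  + ci * inner (x - ci *: y) (x - ci *: y).
Proof.
rewrite !(innerDl, innerDr, innerNl, innerNr, innerZl, innerZr).
have -> : cj (ci : R[i]) = - ci by rewrite /= /GRing.opp/= oppr0.
have := @sqr_i R; rewrite expr2; move: (ci : R[i]) => j jj.
set a := inner x x; set b := inner x y; set c := inner y x; set d := inner y y.
ring: jj.
Qed.

End InnerProduct.

(** * Projections and the Riesz representation *)

Section Completeness.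
Variables (R : realType) (H : hilbertType R).
Implicit Types x y z s p : H.

Lemma inv_succ_lt (e : R) : 0 < e ->
  exists N, forall n, (N <= n)%N -> n.+1%:R^-1 < e.
Proof.
move=> e0; exists (Num.bound e^-1) => n Nn.
rewrite invf_plt ?posrE//.
apply: lt_le_trans (archi_boundP _) _; first by rewrite invr_ge0 ltW.
by rewrite ler_nat (leq_trans Nn).
Qed.

Lemma le_all_eq0 (a : R) : 0 <= a -> (forall e, 0 < e -> a <= e) -> a = 0.
Proof.
move=> a0 ae; apply/eqP; rewrite eq_le a0 andbT leNgt; apply/negP => a1.
by have := ae (a / 2) ltac:(by rewrite divr_gt0); lra.
Qed.

Lemma cauchy_seq_cvg (u : nat -> H) :
  (forall e : R, 0 < e -> exists N, forall m n, (N <= m)%N -> (N <= n)%N ->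
     nrm (u m - u n) < e) ->
  exists l, forall e : R, 0 < e -> exists N, forall n, (N <= n)%N ->
     nrm (l - u n) < e.
Proof.
move=> uC.
have : cauchy (u @ \oo).
  apply/cauchy_exP => eps; rewrite ltcE => /andP[/eqP ime e0].
  have [N uN] := uC (Re eps) e0; exists (u N), N => // n /= Nn.
  rewrite -ball_normE/= nrmE ltcE/= ime eqxx/=.
  exact: uN.
move=> /cauchy_cvg/cvg_ex[l ul]; exists l => e e0.
have /cvgrPdist_lt/(_ e%:C) := ul; rewrite ltcR => /(_ e0)[N _ uN].
by exists N => n Nn; have := uN n Nn; rewrite /= nrmE ltcR.
Qed.

Definition is_subspace (S : set H) :=
  S 0 /\ forall k x y, S x -> S y -> S (k *: x + y).

Lemma subspaceZ S k x : is_subspace S -> S x -> S (k *: x).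
Proof. by move=> [S0 Sl] Sx; rewrite -[k *: x]addr0; apply: Sl. Qed.

Lemma subspaceD S x y : is_subspace S -> S x -> S y -> S (x + y).
Proof. by move=> [S0 Sl] Sx Sy; rewrite -[x]scale1r; apply: Sl. Qed.

(* For every vector s of S, minimality of the distance forces
   |<s, x - s_n>|^2 to be of the order of the excess 1/(n+1). *)
Lemma almost_orthogonal S x s t (d e : R) : is_subspace S -> S s -> S t ->
  (forall y, S y -> d <= nrm (x - y) ^+ 2) -> nrm (x - t) ^+ 2 <= d + e ->
  cabs (inner s (x - t)) ^+ 2 <= (nrm s ^+ 2 + 1) * e.
Proof.
move=> Ssub Ss St dS te.
set a := inner s (x - t); set M := nrm s ^+ 2.
have M0 : 0 <= M by rewrite sqr_ge0.
(* The optimal coefficient is a / M; dividing by M + 1 instead covers s = 0 as well. *)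
pose c := ((M + 1)^-1)%:C * a.
have := dS (t + c *: s) (subspaceD Ssub St (subspaceZ c Ssub Ss)).
rewrite opprD addrA nrm_sqrB nrmZ innerZr (innerC _ s) -/a /c.
rewrite -mulrA [a * _]mulrC mul_conj -rmorphM/= exprMn cabsM cabs_real -/M.
set g := cabs a ^+ 2.
have g0 : 0 <= g by rewrite sqr_ge0.
have M1 : 0 < M + 1 by lra.
rewrite ger0_norm ?invr_ge0 ?(ltW M1)// exprMn -/g => h.
have {}h : 2 * ((M + 1)^-1 * g) - (M + 1)^-1 ^+ 2 * g * M <= e by lra.
rewrite mulrC -ler_pdivrMr//; apply: le_trans h.
rewrite -subr_ge0 (_ : _ - _ = g / (M + 1) ^+ 2); last by field; lra.
by rewrite divr_ge0 ?sqr_ge0.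
Qed.

(** [S] need not be closed: [p] is the projection onto its closure, described by approximation from
    [S] and orthogonality of the rest. A minimizing sequence is Cauchy by the parallelogram law. *)
Lemma projection S x : is_subspace S -> exists p,
  (forall e : R, 0 < e -> exists2 s, S s & nrm (p - s) < e) /\
  forall s, S s -> inner s (x - p) = 0.
Proof.
move=> Ssub.
pose D := [set nrm (x - s) ^+ 2 | s in S].
have Dinf : has_inf D.
  split; first by exists (nrm (x - 0) ^+ 2), 0 => //; case: Ssub.
  by exists 0 => _ [s _ <-]; rewrite sqr_ge0.
pose d := inf D.
have dS y : S y -> d <= nrm (x - y) ^+ 2.
  by move=> Sy; apply: ge_inf; [case: Dinf | exists y].
have /choice[u uP] (n : nat) : exists s, S s /\ nrm (x - s) ^+ 2 <= d + n.+1%:R^-1.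
  have n0 : 0 < n.+1%:R^-1 :> R by rewrite invr_gt0.
  have [_ [s Ss <-] sd] := inf_adherent n0 Dinf.
  by exists s; split => //; apply: ltW.
have key (a b a1 b1 c1 d1 e1 : R) : a1 <= d1 + a -> b1 <= d1 + b -> d1 <= c1 ->
  4 * c1 + e1 = 2 * a1 + 2 * b1 -> e1 <= 2 * a + 2 * b by lra.
have key2 (a b f c : R) : a < f / 4 -> b < f / 4 -> c <= 2 * a + 2 * b -> c < f.
  by lra.
have uC m n : nrm (u m - u n) ^+ 2 <= 2 * m.+1%:R^-1 + 2 * n.+1%:R^-1.
  have [Sm dm] := uP m; have [Sn dn] := uP n.
  have := parallelogram (x - u m) (x - u n).
  (* The midpoint of u_m and u_n lies in S, so its distance to x bounds this term from below. *)
  have -> : x - u m + (x - u n) = 2%:R%:C *: (x - (2^-1)%:C *: (u m + u n)).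
    rewrite scalerBr scalerA -rmorphM/= mulfV ?pnatr_eq0// scale1r.
    by rewrite rmorph_nat scaler_nat mulr2n opprD addrACA.
  rewrite nrmZ exprMn cabs_real -normrX ger0_norm ?sqr_ge0//.
  have -> : x - u m - (x - u n) = - (u m - u n).
    by rewrite !opprB [LHS]addrC addrA subrK.
  rewrite nrmN.
  have := dS _ (subspaceZ (2^-1)%:C Ssub (subspaceD Ssub Sm Sn)).
  rewrite (_ : 2 ^+ 2 = 4 :> R); last by ring.
  by move=> dc eq4; apply: key dm dn dc eq4.
have [p pP] : exists l, forall e : R, 0 < e -> exists N, forall n, (N <= n)%N ->
     nrm (l - u n) < e.
  apply: cauchy_seq_cvg => e e0.
  have [N Ne] := @inv_succ_lt (e ^+ 2 / 4) ltac:(by rewrite divr_gt0// exprn_gt0).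
  exists N => m n Nm Nn.
  rewrite -(@ltr_pXn2r _ 2)// ?nnegrE ?nrm_ge0 ?(ltW e0)//.
  exact: key2 (Ne m Nm) (Ne n Nn) (uC m n).
exists p; split.
  by move=> e e0; have [N /(_ N (leqnn _))] := pP e e0; exists (u N) => //; case: (uP N).
move=> s Ss; apply: cabs_eq0; apply: le_all_eq0 (cabs_ge0 _) _ => e e0.
have M0 : 0 < nrm s ^+ 2 + 1 by rewrite ltr_wpDl ?sqr_ge0.
have [N1 N1e] := @inv_succ_lt ((e / 2) ^+ 2 / (nrm s ^+ 2 + 1))
  ltac:(by rewrite divr_gt0// exprn_gt0// divr_gt0).
have s0 : 0 < nrm s + 1 by rewrite ltr_wpDl ?nrm_ge0.
have [N2 N2e] := pP (e / 2 / (nrm s + 1)) ltac:(by rewrite !divr_gt0).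
pose n := maxn N1 N2.
have -> : x - p = (x - u n) + (u n - p) by rewrite addrA subrK.
rewrite innerDr (splitr e); apply: le_trans (cabsD _ _) (lerD _ _).
  apply: ler_of_sqr; first by rewrite divr_ge0// ltW.
  apply: le_trans (almost_orthogonal Ssub Ss (uP n).1 dS (uP n).2) _.
  by rewrite mulrC -ler_pdivlMr// ltW// N1e// leq_maxl.
apply: le_trans (cauchy_schwarz _ _) _; rewrite nrmB.
have := N2e n (leq_maxr _ _); rewrite ltr_pdivlMr// => h.
apply: le_trans (ltW h); rewrite mulrC ler_wpM2l ?nrm_ge0//; lra.
Qed.

(** The component w of some x0 orthogonal to the kernel spans the complement of the kernel, because
    x - (phi x / phi w) w is always in the kernel. *)
Lemma riesz (phi : H -> R[i]) (C : R) :
  (forall k x y, phi (k *: x + y) = k * phi x + phi y) ->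
  (forall x, cabs (phi x) <= C * nrm x) ->
  exists z, forall x, phi x = inner z x.
Proof.
move=> lphi Cphi.
have phi0 : phi 0 = 0.
  have /eqP := lphi 1 0 0; rewrite scale1r addr0 mul1r -subr_eq0 opprD addrA.
  by rewrite subrr sub0r oppr_eq0 => /eqP.
have phiZ k x : phi (k *: x) = k * phi x.
  by have := lphi k x 0; rewrite phi0 !addr0.
have phiB x y : phi (x - y) = phi x - phi y.
  by rewrite addrC -scaleN1r lphi mulN1r addrC.
have [phix0|] := pselect (forall x, phi x = 0).
  by exists 0 => x; rewrite phix0 inner0l.
move=> /existsNP[x0 x0P].
have Ssub : is_subspace [set x | phi x = 0].
  by split=> //= k x y xS yS; rewrite lphi xS yS mulr0 addr0.
have [p [pS pO]] := projection x0 Ssub.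
have phip : phi p = 0.
  apply: cabs_eq0; apply: le_all_eq0 (cabs_ge0 _) _ => e e0.
  have C0 : 0 < `|C| + 1 by rewrite ltr_wpDl.
  have [s /= s0 ps] := pS (e / (`|C| + 1)) (divr_gt0 e0 C0).
  have -> : phi p = phi (p - s) by rewrite phiB s0 subr0.
  apply: le_trans (Cphi _) _.
  move: ps; rewrite ltr_pdivlMr// => /ltW; apply: le_trans.
  rewrite [leRHS]mulrC ler_wpM2r ?nrm_ge0//.
  by have := ler_norm C; lra.
pose w := x0 - p.
have phiw : phi w != 0 by rewrite phiB phip subr0; apply/eqP.
have w0 : (nrm w ^+ 2)%:C != 0 :> R[i].
  apply: contra_neq phiw => /complexI/eqP; rewrite sqrf_eq0 => /eqP/nrm_eq0 ->.
  exact: phi0.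
exists (cj (phi w / (nrm w ^+ 2)%:C) *: w) => x.
have := pO (x - (phi x / phi w) *: w).
rewrite /= phiB phiZ divfK// subrr => /(_ erefl)/(congr1 cj).
rewrite -innerC innerBr innerZr innerxx => /eqP.
rewrite rmorph0 subr_eq0 => /eqP wx.
rewrite innerZl conjcK wx -/w; move: (nrm w ^+ 2)%:C w0 => m m0; field.
by rewrite phiw m0.
Qed.

End Completeness.

(** * Bounded operators *)

Section BoundedOperators.
Variables (R : realType) (H : hilbertType R).
Implicit Types (x y z : H) (a b c T : H -> H) (S : set (H -> H)).

Definition norm_bound a (C : R) := forall x, nrm (a x) <= C * nrm x.

Lemma linD a : linear a -> {morph a : x y / x + y}.
Proof. by move=> al x y; have := al 1 x y; rewrite !scale1r. Qed.

Lemma lin0 a : linear a -> a 0 = 0.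
Proof.
by move=> /linD aD; have /eqP := aD 0 0; rewrite addr0 eq_sym addrC -subr_eq0 addrK => /eqP.
Qed.

Lemma linZ a k x : linear a -> a (k *: x) = k *: a x.
Proof. by move=> al; have := al k x 0; rewrite (lin0 al) !addr0. Qed.

Lemma linN a x : linear a -> a (- x) = - a x.
Proof. by move=> al; rewrite -scaleN1r linZ// scaleN1r. Qed.

Lemma linB a x y : linear a -> a (x - y) = a x - a y.
Proof. by move=> al; rewrite linD// linN. Qed.

Lemma boundedI a C : linear a -> norm_bound a C -> bounded_operators a.
Proof.
by move=> al aC; split=> //; exists C => x; rewrite !nrmE -rmorphM/= lecR.
Qed.

Lemma bounded_norm a : bounded_operators a -> exists2 C, 0 <= C & norm_bound a C.
Proof.
move=> [al [C aC]]; exists `|C| => // x.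
have := aC x; rewrite !nrmE -rmorphM/= lecR => /le_trans; apply.
by rewrite ler_wpM2r ?nrm_ge0 ?ler_norm.
Qed.

Lemma bounded_id : bounded_operators (@id H).
Proof. by apply: (@boundedI _ 1) => // x; rewrite mul1r. Qed.

Lemma bounded_add a b : bounded_operators a -> bounded_operators b ->
  bounded_operators (a \+ b).
Proof.
move=> /[dup] ab /bounded_norm[C C0 aC] /[dup] bb /bounded_norm[D D0 bD].
apply: (@boundedI _ (C + D)) => [k x y|x] /=.
  by rewrite ab.1 bb.1 scalerDr addrACA.
by rewrite mulrDl (le_trans (nrmD _ _))// lerD.
Qed.

Lemma bounded_scale (k : R[i]) a : bounded_operators a ->
  bounded_operators (k \*: a).
Proof.
move=> /[dup] ab /bounded_norm[C C0 aC].
apply: (@boundedI _ (cabs k * C)) => [l x y|x] /=.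
  by rewrite ab.1 scalerDr !scalerA mulrC.
by rewrite nrmZ -mulrA ler_wpM2l ?cabs_ge0.
Qed.

Lemma bounded_comp a b : bounded_operators a -> bounded_operators b ->
  bounded_operators (a \o b).
Proof.
move=> /[dup] ab /bounded_norm[C C0 aC] /[dup] bb /bounded_norm[D D0 bD].
apply: (@boundedI _ (C * D)) => [k x y|x] /=; first by rewrite bb.1 ab.1.
by rewrite (le_trans (aC _))// -mulrA ler_wpM2l.
Qed.

Lemma adjoint_sym a b : is_adjoint a b -> is_adjoint b a.
Proof. by move=> ab x y; rewrite innerC -ab -innerC. Qed.

Lemma adjoint_uniq a b c : is_adjoint a b -> is_adjoint a c -> b = c.
Proof.
move=> ab ac; apply/funext => x; apply: inner_inj => z.
by rewrite innerC -ab ac -innerC.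
Qed.

Lemma adjointD a a' b b' : is_adjoint a a' -> is_adjoint b b' ->
  is_adjoint (a \+ b) (a' \+ b').
Proof. by move=> aa bb x y; rewrite /= innerDr innerDl aa bb. Qed.

Lemma adjointZ (k : R[i]) a b : is_adjoint a b -> is_adjoint (k \*: a) (cj k \*: b).
Proof. by move=> ab x y; rewrite /= innerZr innerZl conjcK ab. Qed.

Lemma adjointM a a' b b' : is_adjoint a a' -> is_adjoint b b' ->
  is_adjoint (a \o b) (b' \o a').
Proof. by move=> aa bb x y; rewrite /= aa bb. Qed.

Lemma adjoint_bound a b C : 0 <= C -> is_adjoint a b -> norm_bound a C -> norm_bound b C.
Proof.
move=> C0 ab aC x; have [bx0|bx0] := eqVneq (nrm (b x)) 0.
  by rewrite bx0 mulr_ge0 ?nrm_ge0.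
have nb : 0 < nrm (b x) by rewrite lt_def bx0 nrm_ge0.
rewrite -(ler_pM2r nb) -expr2.
have -> : nrm (b x) ^+ 2 = Re (inner x (a (b x))) by rewrite ab innerxx.
apply: le_trans (Re_le_cabs _) _; apply: le_trans (cauchy_schwarz _ _) _.
by rewrite -mulrA mulrCA ler_wpM2l ?nrm_ge0.
Qed.

Lemma adjoint_bounded a b : bounded_operators a -> is_adjoint a b ->
  bounded_operators b.
Proof.
move=> /bounded_norm[C C0 aC] ab; apply: (@boundedI _ C).
  move=> k x y; apply: inner_inj => z; rewrite innerDr innerZr !(adjoint_sym ab).
  by rewrite innerDr innerZr.
exact: adjoint_bound ab aC.
Qed.

Lemma adjoint_exists a : bounded_operators a -> exists b, is_adjoint a b.
Proof.
move=> /[dup] ab /bounded_norm[C C0 aC].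
suff /choice[b bP] : forall y, exists z, forall x, inner y (a x) = inner z x.
  by exists b => x y; rewrite bP.
move=> y; apply: (@riesz _ _ _ (nrm y * C)) => [k x z|x].
  by rewrite ab.1 innerDr innerZr.
by apply: le_trans (cauchy_schwarz _ _) _; rewrite -mulrA ler_wpM2l ?nrm_ge0.
Qed.

Definition seq_cvg (u : nat -> H) (l : H) := forall e : R, 0 < e ->
  exists N, forall n, (N <= n)%N -> nrm (l - u n) < e.

Lemma nrm_lim_eq x y : (forall e : R, 0 < e -> nrm (x - y) <= e) -> x = y.
Proof.
by move=> /le_all_eq0-/(_ (nrm_ge0 _))/nrm_eq0/eqP; rewrite subr_eq0 => /eqP.
Qed.

Lemma seq_cvg_unique u l m : seq_cvg u l -> seq_cvg u m -> l = m.
Proof.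
move=> ul um; apply: nrm_lim_eq => e e0.
have e2 : 0 < e / 2 by rewrite divr_gt0.
have [N1 h1] := ul _ e2; have [N2 h2] := um _ e2.
have {}h1 := h1 _ (leq_maxl N1 N2); have {}h2 := h2 _ (leq_maxr N1 N2).
apply: le_trans (nrm_tri _ (u (maxn N1 N2)) _) _; rewrite (nrmB (u _)) (splitr e).
by rewrite lerD// ltW.
Qed.

Lemma seq_cvgD u v l m : seq_cvg u l -> seq_cvg v m ->
  seq_cvg (fun n => u n + v n) (l + m).
Proof.
move=> ul um e e0.
have e2 : 0 < e / 2 by rewrite divr_gt0.
have [N1 h1] := ul _ e2; have [N2 h2] := um _ e2.
exists (maxn N1 N2) => n; rewrite geq_max => /andP[n1 n2].
rewrite opprD addrACA (splitr e); apply: le_lt_trans (nrmD _ _) _.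
by rewrite ltrD ?h1 ?h2.
Qed.

Lemma seq_cvg_bounded a u l : bounded_operators a -> seq_cvg u l ->
  seq_cvg (a \o u) (a l).
Proof.
move=> /[dup] ab /bounded_norm[C C0 aC] ul e e0.
have C1 : 0 < C + 1 by rewrite ltr_wpDl.
have [N h] := ul _ (divr_gt0 e0 C1).
exists N => n /h; rewrite /= -(linB _ _ ab.1) ltr_pdivlMr// => h'.
apply: le_lt_trans (aC _) _; apply: le_lt_trans h'.
by rewrite mulrDr mulr1 mulrC lerDl nrm_ge0.
Qed.

Lemma seq_cvgZ k u l : seq_cvg u l -> seq_cvg (fun n => k *: u n) (k *: l).
Proof. exact: (seq_cvg_bounded (bounded_scale k bounded_id)). Qed.

Lemma seq_cvg_shift u l : seq_cvg u l -> seq_cvg (fun n => u n.+1) l.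
Proof.
by move=> ul e /ul[N h]; exists N => n Nn; apply: h; rewrite leqW.
Qed.

Lemma seq_cvg_cst l : seq_cvg (fun=> l) l.
Proof. by move=> e e0; exists 0%N => n _; rewrite subrr nrm0. Qed.

Lemma seq_cvg_nrm_le u l (C : R) : seq_cvg u l -> (forall n, nrm (u n) <= C) ->
  nrm l <= C.
Proof.
move=> ul uC; rewrite leNgt; apply/negP => Cl.
have [N h] := ul _ (eq_ind_r is_true Cl (subr_gt0 _ _)).
have := h _ (leqnn _); have := nrmD (l - u N) (u N); rewrite subrK.
by have := uC N; lra.
Qed.

Lemma seq_cvg_inner_eq u v l m x y : seq_cvg u l -> seq_cvg v m ->
  (forall n, inner x (u n) = inner (v n) y) -> inner x l = inner m y.
Proof.
move=> ul vm uv; apply/eqP; rewrite -subr_eq0; apply/eqP/cabs_eq0.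
apply: le_all_eq0 (cabs_ge0 _) _ => e e0.
have x1 : 0 < nrm x + 1 by rewrite ltr_wpDl ?nrm_ge0.
have y1 : 0 < nrm y + 1 by rewrite ltr_wpDl ?nrm_ge0.
have e2 : 0 < e / 2 by rewrite divr_gt0.
have [N1 h1] := ul _ (divr_gt0 e2 x1); have [N2 h2] := vm _ (divr_gt0 e2 y1).
have {}h1 := h1 _ (leq_maxl N1 N2); have {}h2 := h2 _ (leq_maxr N1 N2).
set n := maxn N1 N2 in h1 h2.
have -> : inner x l - inner m y = inner x (l - u n) - inner (m - v n) y.
  by rewrite innerBr innerBl uv; ring.
rewrite (splitr e); apply: le_trans (cabsD _ _) (lerD _ _).
  apply: le_trans (cauchy_schwarz _ _) _; move: h1; rewrite ltr_pdivlMr// => h.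
  by apply: le_trans (ltW h); rewrite mulrC ler_wpM2l ?nrm_ge0// lerDl.
rewrite cabsN.
apply: le_trans (cauchy_schwarz _ _) _; move: h2; rewrite ltr_pdivlMr// => h.
by apply: le_trans (ltW h); rewrite ler_wpM2l ?nrm_ge0// lerDl.
Qed.

Lemma bounded_mono_cauchy (c : nat -> R) (M e : R) : 0 < e ->
  (forall n, c n <= c n.+1) -> (forall n, c n <= M) ->
  exists N, forall m n, (N <= m)%N -> (m <= n)%N -> c n - c m < e.
Proof.
move=> e0 cc cM.
have mono m n : (m <= n)%N -> c m <= c n.
  by move=> mn; apply: (@homo_leq _ c <=%R) => //; apply: le_trans.
have csup : has_sup (range c).
  by split; [exists (c 0%N), 0%N | exists M => _ [n _ <-]].
have [_ [N _ <-] cN] := sup_adherent e0 csup.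
exists N => m n Nm mn.
have : c n <= sup (range c) by apply: sup_ubound; [case: csup | exists n].
by have := mono _ _ Nm; lra.
Qed.

(** The increments are dominated by those of a bounded monotone real sequence, which telescope. No
    geometric rate is required, so the square root iteration converges even at the bound t = 1. *)
Lemma operator_limit (b : nat -> H -> H) (c : nat -> R) (M : R) :
  (forall n, linear (b n)) ->
  (forall n x, nrm (b n.+1 x - b n x) <= (c n.+1 - c n) * nrm x) ->
  (forall n, c n <= c n.+1) -> (forall n, c n <= M) ->
  exists2 b', linear b' & forall x, seq_cvg (b ^~ x) (b' x).
Proof.
move=> bl bc cc cM.
have inc n k x : nrm (b (n + k)%N x - b n x) <= (c (n + k)%N - c n) * nrm x.
  elim: k => [|k IH]; first by rewrite addn0 !subrr nrm0 mul0r.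
  apply: le_trans (nrm_tri _ (b (n + k)%N x) _) _; rewrite addnS.
  rewrite (_ : c _ - c n = c (n + k).+1 - c (n + k)%N + (c (n + k)%N - c n)).
    by rewrite mulrDl lerD.
  by rewrite addrA subrK.
have /choice[b' b'P] x : exists l, seq_cvg (b ^~ x) l.
  apply: cauchy_seq_cvg => e e0.
  have x1 : 0 < nrm x + 1 by rewrite ltr_wpDl ?nrm_ge0.
  have [N NP] := bounded_mono_cauchy (divr_gt0 e0 x1) cc cM.
  have le m n : (N <= m)%N -> (m <= n)%N -> nrm (b n x - b m x) < e.
    move=> Nm mn; have := NP _ _ Nm mn; rewrite ltr_pdivlMr// => h.
    rewrite -(subnKC mn); apply: le_lt_trans (inc _ _ _) _.
    rewrite subnKC//; apply: le_lt_trans h.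
    rewrite ler_wpM2l ?lerDl// subr_ge0.
    by apply: (@homo_leq _ c <=%R) => //; apply: le_trans.
  exists N => m n Nm Nn; case: (leqP m n) => mn; last by rewrite le// ltnW.
  by rewrite nrmB le.
exists b' => // k x y; apply: seq_cvg_unique (b'P _) _.
under [X in seq_cvg X _]funext do rewrite bl.
by apply: seq_cvgD => //; apply: seq_cvgZ.
Qed.

End BoundedOperators.

(** * Square roots *)

Section SquareRoot.
Variables (R : realType) (H : hilbertType R).
Implicit Types (x y z : H) (a b c T : H -> H) (S : set (H -> H)).

(* The solution b of b = (T + b^2)/2, i.e. 1 - sqrt (1 - T), as the limit of
   b_{n+1} = (T + b_n^2)/2; the same recursion on the bound t of T majorizes
   the norms of the increments. *)
Fixpoint sqrt_iter T n : H -> H :=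
  if n is m.+1 then
    fun x => (2^-1)%:C *: (T x + sqrt_iter T m (sqrt_iter T m x))
  else fun=> 0.

Fixpoint sqrt_major (t : R) n : R :=
  if n is m.+1 then 2^-1 * (t + sqrt_major t m ^+ 2) else 0.

Lemma sqrt_major_bounds (t : R) n : 0 <= t <= 1 ->
  [/\ 0 <= sqrt_major t n, sqrt_major t n <= t & sqrt_major t n <= sqrt_major t n.+1].
Proof.
move=> /andP[t0 t1]; elim: n => [|n [c0 ct cc]] /=.
  by split => //; rewrite expr0n/= addr0 mulr_ge0 ?invr_ge0.
have c20 : 0 <= sqrt_major t n ^+ 2 by rewrite sqr_ge0.
have c2t : sqrt_major t n ^+ 2 <= t.
  by rewrite expr2; apply: le_trans (ler_piMl c0 (le_trans ct t1)) ct.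
split; [by rewrite mulr_ge0 ?invr_ge0// addr_ge0 | lra |].
by rewrite ler_wpM2l ?invr_ge0// lerD2l ler_pXn2r// nnegrE; apply: le_trans cc.
Qed.

Variables (T : H -> H) (t : R).
Hypothesis Tlin : linear T.
Hypothesis Tt : norm_bound T t.
Hypothesis t01 : 0 <= t <= 1.

Local Notation b := (sqrt_iter T).
Local Notation c := (sqrt_major t).

Lemma sqrt_iter_linear n : linear (b n).
Proof.
elim: n => [|n IH] k x y /=; first by rewrite scaler0 addr0.
by rewrite Tlin !IH addrACA -scalerDr [LHS]scalerDr !scalerA (mulrC k).
Qed.

Lemma sqrt_iter_bound n : norm_bound (b n) (c n).
Proof.
elim: n => [|n IH] x /=; first by rewrite nrm0 mul0r.
have [c0 _ _] := sqrt_major_bounds n t01.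
rewrite nrmZ cabs_real ger0_norm ?invr_ge0// -mulrA ler_wpM2l ?invr_ge0//.
apply: le_trans (nrmD _ _) _; rewrite mulrDl lerD//.
by apply: le_trans (IH _) _; rewrite expr2 -mulrA ler_wpM2l.
Qed.

Lemma sqrt_iter_comm a n : linear a -> (forall x, a (T x) = T (a x)) ->
  forall x, a (b n x) = b n (a x).
Proof.
move=> al aT; elim: n => [|n IH] x /=; first exact: lin0.
by rewrite linZ// linD// aT !IH.
Qed.

Lemma sqrt_iter_comm_iter m n x : b m (b n x) = b n (b m x).
Proof.
apply: sqrt_iter_comm (sqrt_iter_linear _) _ _ => y.
by rewrite -(sqrt_iter_comm _ Tlin).
Qed.

Lemma sqrt_iter_incr n x : nrm (b n.+1 x - b n x) <= (c n.+1 - c n) * nrm x.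
Proof.
elim: n x => [|n IH] x.
  rewrite [b 0%N x]/= [c 0%N]/= !subr0; exact: sqrt_iter_bound.
(* Since the iterates commute, b_{n+1}^2 - b_n^2 = (b_{n+1} + b_n)(b_{n+1} - b_n), exactly as for
   the majorant c. *)
have -> : b n.+2 x - b n.+1 x =
    (2^-1)%:C *: (b n.+1 (b n.+1 x - b n x) + b n (b n.+1 x - b n x)).
  rewrite !(linB _ _ (sqrt_iter_linear _)) (sqrt_iter_comm_iter n.+1 n x).
  rewrite addrA subrK [LHS]/= -/(b n.+1) -scalerBr; congr (_ *: _).
  by rewrite opprD addrACA subrr add0r.
rewrite nrmZ cabs_real ger0_norm ?invr_ge0//.
have [c0 _ cc] := sqrt_major_bounds n t01.
have [c1 _ _] := sqrt_major_bounds n.+1 t01.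
set y := _ - _; have yle : nrm y <= (c n.+1 - c n) * nrm x := IH x.
have -> : c n.+2 - c n.+1 = 2^-1 * ((c n.+1 + c n) * (c n.+1 - c n)).
  by rewrite [c n.+2]/= -/(c n.+1) {2}[c n.+1]/=; ring.
rewrite -!mulrA ler_wpM2l ?invr_ge0//; apply: le_trans (nrmD _ _) _.
rewrite mulrDl; apply: lerD; apply: le_trans (sqrt_iter_bound _ _) _;
  by rewrite ler_wpM2l.
Qed.

(** With d the limit of the iterates, s = 1 - d: the fixed point equation T + d^2 = 2 d says (1 -
    d)^2 = 1 - T. Commutation and self-adjointness pass from the iterates to the limit. *)
Lemma sqrt_operator : exists s,
  [/\ linear s, forall x, s (s x) = x - T x, forall x, nrm (x - s x) <= t * nrm x,
      (forall a, bounded_operators a -> (forall x, a (T x) = T (a x)) ->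
         forall x, a (s x) = s (a x)) &
      (is_adjoint T T -> is_adjoint s s)].
Proof.
have cn n := sqrt_major_bounds n t01.
have [d dl bd] : exists2 d, linear d & forall x, seq_cvg (b ^~ x) (d x).
  apply: (@operator_limit _ _ b c t) => [||n|n].
  - exact: sqrt_iter_linear.
  - exact: sqrt_iter_incr.
  - by case: (cn n).
  - by case: (cn n).
have dt x : nrm (d x) <= t * nrm x.
  apply: seq_cvg_nrm_le (bd x) _ => n.
  by apply: le_trans (sqrt_iter_bound _ _) _; rewrite ler_wpM2r ?nrm_ge0//; case: (cn n).
have dd x : T x + d (d x) = 2%:R *: d x.
  have : seq_cvg (fun n => (2^-1)%:C *: (T x + b n (b n x)))
                 ((2^-1)%:C *: (T x + d (d x))).
    apply/seq_cvgZ/seq_cvgD; first exact: seq_cvg_cst.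
    move=> e e0; have e2 : 0 < e / 2 by rewrite divr_gt0.
    have [N1 h1] := bd (d x) _ e2; have [N2 h2] := bd x _ e2.
    exists (maxn N1 N2) => n; rewrite geq_max => /andP[n1 n2].
    apply: le_lt_trans (nrm_tri _ (b n (d x)) _) _; rewrite (splitr e).
    rewrite ltrD ?h1// -(linB _ _ (sqrt_iter_linear _)).
    apply: le_lt_trans (h2 _ n2); apply: le_trans (sqrt_iter_bound _ _) _.
    rewrite ler_piMl ?nrm_ge0//; case: (cn n) => _ ct _; apply: le_trans ct _.
    by case/andP: t01.
  move=> /(seq_cvg_unique (seq_cvg_shift (bd x))) dx.
  have two : 2%:R = (2%:R)%:C :> R[i] by rewrite rmorph_nat.
  by rewrite {2}dx scalerA two -rmorphM/= mulfV ?pnatr_eq0// scale1r.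
exists (fun x => x - d x); split.
- by move=> k x y; rewrite dl scalerBr opprD addrACA.
- move=> x; rewrite linB// opprB addrA.
  have -> : x - d x + d (d x) - d x = x + d (d x) - 2%:R *: d x.
    by rewrite scaler_nat mulr2n opprD addrA -!addrA [_ + (d _ - _)]addrCA.
  by rewrite -dd opprD addrA addrAC addrK.
- by move=> x; rewrite opprB addrCA subrr addr0.
- move=> a ab aT x; rewrite (linB _ _ ab.1); congr (_ - _).
  apply: seq_cvg_unique (seq_cvg_bounded ab (bd x)) _.
  have -> : a \o b ^~ x = b ^~ (a x).
    by apply/funext => n /=; rewrite (sqrt_iter_comm _ ab.1).
  exact: bd.
- move=> TT.
  have bb n : is_adjoint (b n) (b n).
    elim: n => [|n IH] x y /=; first by rewrite inner0l inner0r.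
    by rewrite innerZr innerZl conjc_real innerDr innerDl TT !IH.
  move=> x y; rewrite innerBr innerBl; congr (_ - _).
  by apply: seq_cvg_inner_eq (bd y) (bd x) _ => n; apply: bb.
Qed.

End SquareRoot.

(** * Commutants and unitaries; the Uhlmann property implies Haag duality *)

Section Commutants.
Variables (R : realType) (H : hilbertType R).
Implicit Types (x y z : H) (a b c k u v : H -> H) (S M : set (H -> H)).

Definition adjoint_closed S := forall a, S a -> exists2 b, S b & is_adjoint a b.

Lemma commutant_bounded S : commutant S `<=` bounded_operators (H:=H).
Proof. by move=> a []. Qed.

Lemma commutantE S a b x : commutant S a -> S b -> a (b x) = b (a x).
Proof. by move=> [_ /[apply]] /(congr1 (fun f => f x)). Qed.

Lemma commutantI S a : bounded_operators a ->
  (forall b x, S b -> a (b x) = b (a x)) -> commutant S a.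
Proof. by move=> ab aS; split=> // b Sb; apply/funext => x; apply: aS. Qed.

Lemma commutant_star S : S `<=` bounded_operators (H:=H) -> adjoint_closed S ->
  star_subalgebra (commutant S).
Proof.
move=> Sb Sadj; split.
- exact: commutant_bounded.
- exact: commutantI (bounded_id _) _.
- move=> a b aS bS; apply: commutantI => [|c x Sc /=].
    exact: bounded_add aS.1 bS.1.
  by rewrite (commutantE _ aS)// (commutantE _ bS)// (linD (Sb _ Sc).1).
- move=> l a aS; apply: commutantI => [|c x Sc /=]; first exact: bounded_scale aS.1.
  by rewrite (commutantE _ aS)// (linZ _ _ (Sb _ Sc).1).
- move=> a b aS bS; apply: commutantI => [|c x Sc /=].
    exact: bounded_comp aS.1 bS.1.
  by rewrite (commutantE _ bS)// (commutantE _ aS).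
- move=> a aS; have [b ab] := adjoint_exists aS.1; exists b => //.
  apply: commutantI => [|c x Sc]; first exact: adjoint_bounded aS.1 ab.
  have [d Sd cd] := Sadj _ Sc.
  apply: inner_inj => z; rewrite (adjoint_sym ab) cd -(commutantE _ aS Sd).
  by rewrite cd (adjoint_sym ab).
Qed.

Lemma commutant_anti S1 S2 : S1 `<=` S2 -> commutant S2 `<=` commutant (H:=H) S1.
Proof. by move=> S12 a [ab aS]; split=> // b /S12; apply: aS. Qed.

Lemma sub_commutant2 S : S `<=` bounded_operators (H:=H) ->
  S `<=` commutant (commutant S).
Proof. by move=> Sb a Sa; split; [apply: Sb | move=> b [_ bS]; rewrite bS]. Qed.

Lemma commutant3 S : S `<=` bounded_operators (H:=H) ->
  commutant (commutant (commutant S)) = commutant S.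
Proof.
move=> Sb; rewrite eqEsubset; split.
  exact/commutant_anti/sub_commutant2.
exact/sub_commutant2/commutant_bounded.
Qed.

Lemma von_neumann_commutant S : S `<=` bounded_operators (H:=H) ->
  adjoint_closed S -> von_neumann_algebra (commutant S).
Proof. by move=> Sb Sadj; split; [apply: commutant_star | rewrite commutant3]. Qed.

(** The two conditions on [l] hold for i and for -i, so one proof gives both s + i k and s - i k. *)
Lemma unitary_sum s k (l : R[i]) : linear s -> linear k ->
  is_adjoint s s -> is_adjoint k k -> (forall x, s (k x) = k (s x)) ->
  (forall x, s (s x) + k (k x) = x) -> cj l = - l -> l * l = -1 ->
  unitary_operator (s \+ l \*: k).
Proof.
move=> sl kl ss kk sk sq lN ll; exists (s \+ - l \*: k).
split; first by have := adjointD ss (adjointZ l kk); rewrite lN.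
- apply/funext => x /=; rewrite (linD sl) (linD kl) !(linZ _ _ sl) !(linZ _ _ kl).
  rewrite sk scalerDr !scalerA mulrN ll opprK scale1r scaleNr addrA subrK.
  exact: sq.
- apply/funext => x /=; rewrite (linD sl) (linD kl) !(linZ _ _ sl) !(linZ _ _ kl).
  rewrite sk scalerDr !scalerA mulNr ll opprK scale1r scaleNr addrA addrK.
  exact: sq.
Qed.

(** s = sqrt (1 - k^2) stays in the commutant because it commutes with all that commutes with k^2.
    It differs from 1 only by t^2, a second order error while k itself has size t. *)
Lemma commutant_unitary_pair S k (t : R) : S `<=` bounded_operators (H:=H) ->
  commutant S k -> is_adjoint k k -> norm_bound k t -> 0 <= t <= 1 ->
  exists s, [/\ commutant S s, (forall x, nrm (x - s x) <= t ^+ 2 * nrm x),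
    unitary_operator (s \+ ci \*: k) & unitary_operator (s \+ - ci \*: k)].
Proof.
move=> Sb kS kk kt /andP[t0 t1].
have kl : linear k by case: kS => -[].
have [] := @sqrt_operator _ _ (k \o k) (t ^+ 2).
- by move=> l x y /=; rewrite kl kl.
- move=> x /=; apply: le_trans (kt _) _.
  by rewrite expr2 -mulrA ler_wpM2l.
- by rewrite sqr_ge0 expr_le1.
move=> s [sl sq st sC /(_ (adjointM kk kk)) ss].
have sb : bounded_operators s.
  apply: (@boundedI _ _ _ (1 + t ^+ 2)) => // x.
  rewrite -[s x]opprK -[- s x](addKr x) nrmN mulrDl mul1r.
  by apply: le_trans (nrmD _ _) _; rewrite nrmN lerD.
have cS : commutant S s.
  apply: commutantI => // c x Sc; rewrite (sC c)//; first exact: Sb.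
  by move=> y /=; rewrite -!(commutantE _ kS Sc).
have sk x : s (k x) = k (s x).
  by rewrite (sC k)//; case: kS.
have sk2 x : s (s x) + k (k x) = x by rewrite sq /= subrK.
exists s; split => //; apply: unitary_sum => //.
- exact: cj_ci.
- exact: mul_ci.
- exact: cj_Nci.
- by rewrite mulrNN mul_ci.
Qed.

Lemma self_adjoint_parts a b : is_adjoint a b ->
  is_adjoint (a \+ b) (a \+ b) /\ is_adjoint (ci \*: (a \- b)) (ci \*: (a \- b)).
Proof.
move=> ab; have ba := adjoint_sym ab; split => x y /=.
  by rewrite innerDr innerDl ab ba addrC.
by rewrite innerZr innerZl cj_ci innerBr innerBl ab ba mulNr -mulrN opprB.
Qed.

(** The unitaries span the commutant: 2 i k is the difference of s + i k and s - i k for a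
    self-adjoint contraction k; rescaling gives all self-adjoint elements, and b + b' with i (b -
    b') gives all b. *)
Lemma commutant_unitaries S a : S `<=` bounded_operators (H:=H) ->
  adjoint_closed S -> linear a ->
  (forall u x, commutant S u -> unitary_operator u -> a (u x) = u (a x)) ->
  forall b x, commutant S b -> a (b x) = b (a x).
Proof.
move=> Sb Sadj al aU.
have Mstar := commutant_star Sb Sadj.
have diff x y : x + y - (x - y) = y + y by rewrite opprB addrC -addrA addKr.
have dbl x y : x + x = y + y -> x = y.
  have two0 : 2%:R != 0 :> R[i] by rewrite pnatr_eq0.
  by move=> xy; apply: (scalerI two0); rewrite !scaler_nat !mulr2n.
have sum x y : x - y + (x + y) = x + x by rewrite addrACA addNr addr0.
have sa1 k x : commutant S k -> is_adjoint k k -> norm_bound k 1 ->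
    a (k x) = k (a x).
  move=> kS kk k1.
  have [|s [sS _ up um]] := commutant_unitary_pair Sb kS kk k1.
    by rewrite ler01 lexx.
  have kS' l : commutant S (s \+ l \*: k).
    exact: (star_add Mstar sS (star_scale Mstar _ kS)).
  have e1 := aU _ x (kS' ci) up; have e2 := aU _ x (kS' (- ci)) um.
  have := congr2 (fun y z => y - z) e1 e2.
  rewrite /= -(linB _ _ al) !scaleNr !diff (linD al) => /dbl.
  by rewrite (linZ _ _ al) => /(scalerI (ci_neq0 _)).
have sa k x : commutant S k -> is_adjoint k k -> a (k x) = k (a x).
  move=> kS kk; have [C C0 kC] := bounded_norm kS.1.
  have C1 : 0 < C + 1 by rewrite ltr_wpDl.
  have lC : ((C + 1)^-1)%:C != 0 :> R[i].
    by apply/eqP => /complexI/eqP; rewrite invr_eq0 gt_eqF.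
  apply: (scalerI lC); rewrite -(linZ _ _ al).
  apply: (sa1 (((C + 1)^-1)%:C \*: k)).
  - exact: star_scale.
  - by have := adjointZ ((C + 1)^-1)%:C kk; rewrite conjc_real.
  - move=> y /=; rewrite nrmZ cabs_real ger0_norm ?invr_ge0 ?(ltW C1)// mul1r.
    rewrite ler_pdivrMl//; apply: le_trans (kC _) _.
    by rewrite ler_wpM2r ?nrm_ge0// lerDl.
move=> b x bS; have [b' b'S bb'] := star_adj Mstar bS.
have [h1 h2] := self_adjoint_parts bb'.
have N1 : b \- b' = b \+ (-1) \*: b'.
  by apply/funext => y /=; rewrite scaleN1r.
have := sa _ x (star_add Mstar bS b'S) h1.
have : a ((ci \*: (b \- b')) x) = (ci \*: (b \- b')) (a x).
  apply: sa h2; apply: star_scale => //; rewrite N1.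
  exact: (star_add Mstar bS (star_scale Mstar (-1) b'S)).
rewrite /= (linZ _ _ al) => /(scalerI (ci_neq0 _)); rewrite (linB _ _ al) (linD al).
move=> e1 e2; have := congr2 (fun y z => y + z) e1 e2.
by rewrite !sum => /dbl.
Qed.

(** Expanding at y + x and at y + i x gives the sum and the difference of the two cross terms;
    adding the two equations isolates <y, a x>. *)
Lemma quadratic_form_eq0 a : linear a -> (forall x, inner x (a x) = 0) ->
  forall x, a x = 0.
Proof.
move=> al a0 x; apply: inner_eq0 => y.
have h1 := a0 (y + x); have h2 := a0 (y + ci *: x).
move: h1 h2; rewrite !(linD al) (linZ _ _ al) !innerDl !innerDr.
rewrite !innerZl !innerZr !a0 !mulr0 !add0r !addr0 => h1.
rewrite cj_ci mulNr -mulrBr => /eqP; rewrite mulf_eq0 (negPf (ci_neq0 _))/=.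
move/eqP => h2; have := congr2 (fun y z : R[i] => y + z) h1 h2.
rewrite addr0 addrACA subrr addr0 -mulr2n -mulr_natl => /eqP.
by rewrite mulf_eq0 pnatr_eq0 => /eqP.
Qed.

Lemma unitary_nrm u x : unitary_operator u -> nrm (u x) = nrm x.
Proof.
move=> [v [uv _ vu]]; apply/eqP.
rewrite -(@eqrXn2 _ 2) ?nrm_ge0//; apply/eqP/complexI.
rewrite -!innerxx uv; congr (inner _ x); exact: (congr1 (fun f => f x) vu).
Qed.

End Commutants.

Section UhlmannImpliesHaag.
Variables (R : realType) (H : hilbertType R).
Implicit Types (x y z Phi Psi : H) (a b c k u v : H -> H) (MA MB : set (H -> H)).

(* If v Phi is approximated by u Phi up to a phase with u in M_B, then v and u
   act alike on vector states restricted to M_B'. *)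
Lemma uhlmann_state MA MB v a Phi : uhlmann_property MA MB ->
  commutant MA v -> unitary_operator v -> commutant MB a -> nrm Phi = 1 ->
  inner (v Phi) (a (v Phi)) = inner Phi (a Phi).
Proof.
move=> UP vA vu aB Phi1.
have [C C0 aC] := bounded_norm aB.1; have al := aB.1.1.
have vPhi1 : nrm (v Phi) = 1 by rewrite unitary_nrm.
apply/eqP; rewrite -subr_eq0; apply/eqP/cabs_eq0.
apply: le_all_eq0 (cabs_ge0 _) _ => e e0.
have C1 : 0 < 3 * (C + 1) by rewrite mulr_gt0// ltr_wpDl.
(* Replacing v Phi by w costs eta C on each side of the form, and the defect of |w| from 1 costs a
   third eta C. *)
pose eta := Num.min 1 (e / (3 * (C + 1))).
have eta0 : 0 < eta by rewrite lt_min ltr01 divr_gt0.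
have eta1 : eta <= 1 by rewrite ge_min lexx.
have etae : eta * (3 * (C + 1)) <= e.
  by rewrite -ler_pdivlMr// ge_min lexx orbT.
have [||b bA||u [uB uu]] := UP Phi (v Phi) _ _ _ (eta ^+ 2 / 2).
- by rewrite nrmE Phi1.
- by rewrite nrmE vPhi1.
- have [v' [vv' _ v'v]] := vu.
  rewrite -(commutantE _ vA bA) vv'.
  congr (inner _ _); exact: (congr1 (fun f => f Phi) v'v).
- by rewrite divr_gt0// exprn_gt0.
set l := inner (v Phi) (u Phi); rewrite cabsE -rmorphB/= lecR => lge.
have uPhi1 : nrm (u Phi) = 1 by rewrite unitary_nrm.
have l1 : cabs l <= 1.
  by apply: le_trans (cauchy_schwarz _ _) _; rewrite vPhi1 uPhi1 mulr1.
(* w is the projection of v Phi onto the line of u Phi. Its coefficient contains the phase, and |v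
   Phi - w|^2 = 1 - |l|^2. *)
pose w := cj l *: u Phi.
have wn : nrm w = cabs l by rewrite nrmZ cabs_conj uPhi1 mulr1.
have vw : nrm (v Phi - w) <= eta.
  apply: ler_of_sqr; first exact: ltW.
  rewrite nrm_sqrB wn vPhi1 innerZr -/l mul_conj /=.
  have : (1 - eta ^+ 2 / 2) * 1 <= cabs l by rewrite mulr1.
  have := cabs_ge0 l; have := sqr_ge0 (1 - cabs l).
  move: lge l1; set g := cabs l; set f := eta ^+ 2.
  rewrite !expr2; nra.
have ww : inner w (a w) = (cabs l ^+ 2)%:C * inner Phi (a Phi).
  rewrite innerZl conjcK (linZ _ _ al) innerZr mulrA [l * _]mulrC mul_conj.
  rewrite (commutantE _ aB uB); have [u' [uu' _ u'u]] := uu.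
  rewrite uu'; congr (_ * inner _ _); exact: (congr1 (fun f => f Phi) u'u).
have -> : inner (v Phi) (a (v Phi)) - inner Phi (a Phi) =
    inner (v Phi - w) (a (v Phi)) + inner w (a (v Phi - w))
    - (1 - cabs l ^+ 2)%:C * inner Phi (a Phi).
  by rewrite innerBl (linB _ _ al) innerBr ww rmorphB/=; ring.
have av : nrm (a (v Phi)) <= C by have := aC (v Phi); rewrite vPhi1 mulr1.
have aP : nrm (a Phi) <= C by have := aC Phi; rewrite Phi1 mulr1.
apply: le_trans (cabsD _ _) _; rewrite cabsN cabsM cabs_real.
have b1 : cabs (inner (v Phi - w) (a (v Phi)) + inner w (a (v Phi - w))) <= 2 * (eta * C).
  apply: le_trans (cabsD _ _) _; rewrite mulr_natl mulr2n lerD//.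
    by apply: le_trans (cauchy_schwarz _ _) _; rewrite ler_pM ?nrm_ge0.
  apply: le_trans (cauchy_schwarz _ _) _; rewrite wn -[leRHS]mul1r.
  rewrite ler_pM ?cabs_ge0 ?nrm_ge0//; apply: le_trans (aC _) _.
  by rewrite mulrC ler_wpM2r.
have b2 : cabs (inner Phi (a Phi)) <= C.
  by apply: le_trans (cauchy_schwarz _ _) _; rewrite Phi1 mul1r.
have b3 : `|1 - cabs l ^+ 2| <= eta.
  have l0 := cabs_ge0 l; rewrite ger0_norm; last first.
    by rewrite subr_ge0 expr_le1.
  have : eta ^+ 2 <= eta by rewrite expr2 ler_piMl// ltW.
  move: lge l1 l0; set g := cabs l; set f := eta ^+ 2; rewrite !expr2; nra.
have b4 : `|1 - cabs l ^+ 2| * cabs (inner Phi (a Phi)) <= eta * C.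
  by rewrite ler_pM ?cabs_ge0.
by apply: le_trans (lerD b1 b4) _; apply: le_trans etae; nra.
Qed.

Lemma uhlmann_haag MA MB : von_neumann_algebra MA -> von_neumann_algebra MB ->
  commuting_operators MA MB -> uhlmann_property MA MB -> haag_duality MA MB.
Proof.
move=> [sA MA2] [sB MB2] AB UP; rewrite /haag_duality eqEsubset; split.
  move=> b Bb; apply: commutantI => [|a x Aa]; first exact: (star_sub sB).
  by have /(congr1 (fun f => f x)) := AB _ _ Aa Bb.
move=> x xA; rewrite MB2; apply: commutantI => [|a y aB]; first by case: xA.
apply/esym; apply: (commutant_unitaries (star_sub sA) (star_adj sA) aB.1.1) xA.
move=> {x y} v x vA vu; have [v' [vv' vv'1 v'v]] := vu.
have al := aB.1.1; have v'l : linear v'.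
  by case: (adjoint_bounded vA.1 vv').
have vl := vA.1.1.
(* As v v* = 1, it suffices to compare v* a v with a, and their quadratic forms agree on unit
   vectors by [uhlmann_state]. *)
suff /(congr1 v) : v' (a (v x)) = a x.
  by rewrite -[v (v' _)]/((v \o v') _) vv'1.
apply/eqP; rewrite -subr_eq0; apply/eqP.
apply: (@quadratic_form_eq0 _ _ (fun x => v' (a (v x)) - a x)) => {x} [k x y|x].
  by rewrite vl !al v'l scalerBr opprD addrACA.
have [x0|x0] := eqVneq x 0; first by rewrite x0 inner0l.
have nx : nrm x != 0 by apply: contra_neq x0; apply: nrm_eq0.
pose Phi := ((nrm x)^-1)%:C *: x.
have xPhi : x = (nrm x)%:C *: Phi.
  by rewrite scalerA -rmorphM/= mulfV// scale1r.
have Phi1 : nrm Phi = 1.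
  by rewrite nrmZ cabs_real ger0_norm ?invr_ge0 ?nrm_ge0// mulVf.
move: Phi xPhi Phi1 => Phi xPhi Phi1; rewrite innerBr (adjoint_sym vv') xPhi.
rewrite !(linZ _ _ vl) !(linZ _ _ al) !innerZr !innerZl.
by rewrite (uhlmann_state UP vA vu aB Phi1) subrr.
Qed.

End UhlmannImpliesHaag.

(** * Haag duality implies the Uhlmann property *)

Section UnitaryApproximation.
Variables (R : realType) (H : hilbertType R).
Implicit Types (x y z Phi Psi : H) (a b c h k u v : H -> H) (S : set (H -> H)).

Lemma unitary_bound u : unitary_operator u -> norm_bound u 1.
Proof. by move=> uu x; rewrite unitary_nrm// mul1r. Qed.

Lemma unitary_comp u v : unitary_operator u -> unitary_operator v ->
  unitary_operator (u \o v).
Proof.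
move=> [u' [uu uu' u'u]] [v' [vv vv' v'v]]; exists (v' \o u'); split.
- exact: adjointM.
- by rewrite compA -(compA u) vv' compA.
- by rewrite compA -(compA v') u'u compA.
Qed.

Lemma unitary_scale (l : R[i]) u : linear u -> cj l * l = 1 ->
  unitary_operator u -> unitary_operator (l \*: u).
Proof.
move=> ul ll [u' [uu uu' u'u]]; exists (cj l \*: u').
have u'l : linear u'.
  by case: (adjoint_bounded (boundedI ul (unitary_bound (ex_intro _ u' (And3 uu uu' u'u)))) uu).
have e1 x : u (u' x) = x by exact: (congr1 (fun f => f x) uu').
have e2 x : u' (u x) = x by exact: (congr1 (fun f => f x) u'u).
split; first exact: adjointZ.
  by apply/funext => x /=; rewrite (linZ _ _ ul) scalerA mulrC ll e1 scale1r.
by apply/funext => x /=; rewrite (linZ _ _ u'l) scalerA ll e2 scale1r.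
Qed.

(* A self-adjoint contraction h is the mean of the unitaries h + i s and
   h - i s, where s = sqrt (1 - h^2). *)
Lemma self_adjoint_le_unitaries S h Phi Psi (r : R) :
  S `<=` bounded_operators (H:=H) -> adjoint_closed S ->
  commutant S h -> is_adjoint h h -> norm_bound h 1 ->
  (forall u, commutant S u -> unitary_operator u -> Re (inner Psi (u Phi)) <= r) ->
  Re (inner Psi (h Phi)) <= r.
Proof.
move=> Sb Sadj hS hh h1 ur; have Mstar := commutant_star Sb Sadj.
have [|s [sS _ up um]] := commutant_unitary_pair Sb hS hh h1.
  by rewrite ler01 lexx.
have kS l : commutant S (s \+ l \*: h).
  exact: (star_add Mstar sS (star_scale Mstar _ hS)).
have r1 := ur _ (star_scale Mstar (- ci) (kS ci)) (unitary_scale _ _ up).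
have r2 := ur _ (star_scale Mstar ci (kS (- ci))) (unitary_scale _ _ um).
have {}r1 : Re (inner Psi ((- ci \*: (s \+ ci \*: h)) Phi)) <= r.
  apply: r1; first by case: (kS ci) => -[].
  by rewrite cj_Nci mulrNN mulNr mul_ci opprK.
have {}r2 : Re (inner Psi ((ci \*: (s \+ - ci \*: h)) Phi)) <= r.
  apply: r2; first by case: (kS (- ci)) => -[].
  by rewrite cj_ci mulNr mul_ci opprK.
move: r1 r2; rewrite /= !scalerDr !scalerA mulNr mulrN mul_ci opprK scale1r.
rewrite !innerDr !ReD !innerZr mulNr ReN; lra.
Qed.

(* phi = <Psi, . u0 Phi> with u0 a nearly optimal unitary is bounded by s on the
   unitaries, and nearly attains s at 1.  Testing it on the unitaries
   sqrt (1 - t^2 k^2) + i t k for small t makes Im phi (k) small, so that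
   Re phi (h + i k) is at most s up to a small error. *)
Lemma contraction_le_unitaries S (x : H -> H) Phi Psi (e : R) :
  S `<=` bounded_operators (H:=H) -> adjoint_closed S ->
  commutant S x -> norm_bound x 1 -> nrm Phi = 1 -> nrm Psi = 1 -> 0 < e ->
  exists u, [/\ commutant S u, unitary_operator u &
    Re (inner Psi (x Phi)) - e <= Re (inner Psi (u Phi))].
Proof.
move=> Sb Sadj xS x1 Phi1 Psi1 e0; have Mstar := commutant_star Sb Sadj.
pose D := [set r | exists u, [/\ commutant S u, unitary_operator u &
                               r = Re (inner Psi (u Phi))]].
have Dsup : has_sup D.
  split.
    exists (Re (inner Psi Phi)), id; split => //; first exact: (star_unit Mstar).
    by exists id; split.
  exists 1 => _ [u [_ uu ->]]; apply: le_trans (Re_le_cabs _) _.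
  by apply: le_trans (cauchy_schwarz _ _) _; rewrite unitary_nrm// Psi1 Phi1 mulr1.
pose s := sup D.
have sU u : commutant S u -> unitary_operator u -> Re (inner Psi (u Phi)) <= s.
  by move=> uS uu; apply: sup_ubound; [case: Dsup | exists u].
(* Re phi (i k) <= 2 t and phi (1) > s - t^2 lose at most 2 t + t^2 <= 3 t in total. *)
pose t := Num.min 1 (e / 4).
have t0 : 0 < t by rewrite lt_min ltr01 divr_gt0.
have t1 : t <= 1 by rewrite ge_min lexx.
have te : t * 4 <= e by rewrite -ler_pdivlMr// ge_min lexx orbT.
have t20 : 0 < t ^+ 2 by rewrite exprn_gt0.
have [_ [u0 [u0S u0u ->]] u0s] := sup_adherent t20 Dsup.
exists u0; split => //.
have [v0 v0S u0v0] := star_adj Mstar u0S.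
have [v0' [adv0 uv vu]] := u0u.
have vE := adjoint_uniq u0v0 adv0; subst v0'.
have v0u y : v0 (u0 y) = y by exact: (congr1 (fun f => f y) vu).
pose Phi' := u0 Phi.
have sU' u : commutant S u -> unitary_operator u -> Re (inner Psi (u Phi')) <= s.
  by move=> uS uu; apply: (sU (u \o u0)); [apply: (star_mul Mstar) | apply: unitary_comp].
pose x' := x \o v0.
have x'S : commutant S x' by apply: (star_mul Mstar).
have x'1 : norm_bound x' 1.
  move=> y; apply: le_trans (x1 _) _; rewrite ler_pM2l//.
  by have := adjoint_bound ler01 u0v0 (unitary_bound u0u) y; rewrite mul1r.
have [y' y'S xy'] := star_adj Mstar x'S.
have y'1 : norm_bound y' 1 := adjoint_bound ler01 xy' x'1.
have [hh kk] := self_adjoint_parts xy'.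
pose h := (2^-1)%:C \*: (x' \+ y').
pose k := (- 2^-1)%:C \*: (ci \*: (x' \- y')).
have N1 : x' \- y' = x' \+ (-1) \*: y' by apply/funext => y /=; rewrite scaleN1r.
have hS : commutant S h by apply/(star_scale Mstar)/(star_add Mstar).
have kS : commutant S k.
  apply: (star_scale Mstar); apply: (star_scale Mstar); rewrite N1.
  exact: (star_add Mstar x'S (star_scale Mstar (-1) y'S)).
have {}hh : is_adjoint h h by have := adjointZ (2^-1)%:C hh; rewrite conjc_real.
have {}kk : is_adjoint k k by have := adjointZ (- 2^-1)%:C kk; rewrite conjc_real.
have h1 : norm_bound h 1.
  move=> y; rewrite nrmZ cabs_real ger0_norm ?invr_ge0// mul1r ler_pdivrMl//.
  apply: le_trans (nrmD _ _) _.
  by have := x'1 y; have := y'1 y; rewrite !mul1r; lra.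
have k1 : norm_bound k 1.
  move=> y; rewrite !nrmZ cabs_real normrN ger0_norm ?invr_ge0// mul1r ler_pdivrMl//.
  rewrite cabsi mul1r; apply: le_trans (nrmD _ _) _; rewrite nrmN.
  by have := x'1 y; have := y'1 y; rewrite !mul1r; lra.
have xhk : x Phi = h Phi' + ci *: k Phi'.
  rewrite /h /k /= !scalerA mulrAC mul_ci mulN1r -rmorphN/= opprK -scalerDr.
  rewrite addrACA subrr addr0 /x' /= v0u.
  have -> : x Phi + x Phi = 2%:R *: x Phi by rewrite [RHS]scaler_nat mulr2n.
  rewrite scalerA; have -> : 2%:R = (2%:R)%:C :> R[i] by rewrite rmorph_nat.
  by rewrite -rmorphM/= mulVf ?pnatr_eq0// scale1r.
have hle : Re (inner Psi (h Phi')) <= s.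
  exact: (self_adjoint_le_unitaries Sb Sadj hS hh h1 sU').
have tkS : commutant S (t%:C \*: k) by apply: (star_scale Mstar).
have tkk : is_adjoint (t%:C \*: k) (t%:C \*: k).
  by have := adjointZ t%:C kk; rewrite conjc_real.
have tk1 : norm_bound (t%:C \*: k) t.
  move=> y; rewrite nrmZ cabs_real ger0_norm ?(ltW t0)// ler_pM2l//.
  by have := k1 y; rewrite mul1r.
have [|w [wS wt up _]] := commutant_unitary_pair Sb tkS tkk tk1.
  by rewrite (ltW t0) t1.
have uple : Re (inner Psi ((w \+ ci \*: (t%:C \*: k)) Phi')) <= s.
  exact: (sU' _ (star_add Mstar wS (star_scale Mstar _ tkS)) up).
have Phi'1 : nrm Phi' = 1 by rewrite unitary_nrm.
have wle : Re (inner Psi Phi') - t ^+ 2 <= Re (inner Psi (w Phi')).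
  rewrite lerBlDr -lerBlDl -ReN -ReD -innerBr; apply: le_trans (Re_le_cabs _) _.
  apply: le_trans (cauchy_schwarz _ _) _; rewrite Psi1 mul1r.
  by have := wt Phi'; rewrite Phi'1 mulr1.
have kle : Re (inner Psi (ci *: k Phi')) <= 2 * t.
  rewrite -(ler_pM2l t0); move: uple.
  rewrite /= scalerA mulrC -scalerA innerDr ReD (innerZr t%:C) Re_mulr.
  by move: u0s wle; rewrite -/s -/Phi' expr2; lra.
rewrite xhk innerDr ReD; move: u0s; rewrite -/s -/Phi' => u0s.
have : t ^+ 2 <= t by rewrite expr2 ler_piMl// ltW.
by lra.
Qed.

End UnitaryApproximation.

(** * Contractions defined by a graph, extended by zero on the orthogonal complement *)

Section Extension.
Variables (R : realType) (H : hilbertType R).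
Implicit Types (x y z p : H) (G : set (H * H)).

(** [p] is the projection of x onto the closed domain of [G], and (p, y) lies in the closure of [G].
    This is the graph of the continuous extension, zero on the orthogonal complement; with
    uniqueness of y, linearity and commutation become closure properties of a relation. *)
Definition in_closure_graph G x y := exists p : H,
  (forall q, G q -> inner q.1 (x - p) = 0) /\
  forall e : R, 0 < e -> exists2 q, G q & nrm (p - q.1) < e /\ nrm (y - q.2) < e.

Definition linear_graph G := G 0 /\
  forall (k : R[i]) q r, G q -> G r -> G (k *: q + r).

Lemma closure_graph_linear G k x y x' y' : linear_graph G ->
  in_closure_graph G x y -> in_closure_graph G x' y' ->
  in_closure_graph G (k *: x + x') (k *: y + y').
Proof.
move=> [_ Gl] [p [pO pG]] [p' [pO' pG']]; exists (k *: p + p'); split.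
  move=> q Gq.
  rewrite opprD addrACA -scalerBr innerDr innerZr pO// pO'// mulr0 addr0 //.
move=> e e0.
have k1 : 0 < cabs k + 1 by rewrite ltr_wpDl ?cabs_ge0.
have e2 : 0 < e / 2 by rewrite divr_gt0.
have [q Gq [q1 q2]] := pG _ (divr_gt0 e2 k1).
have [r Gr [r1 r2]] := pG' _ e2.
have le u v : nrm (u - v) < e / 2 / (cabs k + 1) -> nrm (k *: u - k *: v) <= e / 2.
  rewrite ltr_pdivlMr// => /ltW; apply: le_trans.
  by rewrite -scalerBr nrmZ mulrC ler_wpM2l ?nrm_ge0// lerDl.
exists (k *: q + r); first exact: Gl.
by split; rewrite opprD addrACA (splitr e); apply: le_lt_trans (nrmD _ _) _;
  rewrite ler_ltD// le.
Qed.

Lemma closure_graph_bound G x y : linear_graph G ->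
  (forall q, G q -> nrm q.2 <= nrm q.1) ->
  in_closure_graph G x y -> nrm y <= nrm x.
Proof.
move=> [G0 Gl] Gle [p [pO pG]].
have yp : nrm y <= nrm p.
  rewrite leNgt; apply/negP => py.
  have e0 : 0 < (nrm y - nrm p) / 2 by rewrite divr_gt0// subr_gt0.
  have [q Gq [q1 q2]] := pG _ e0; have := Gle _ Gq.
  have := nrmD (y - q.2) q.2; rewrite subrK.
  have := nrmD (q.1 - p) p; rewrite subrK nrmB.
  lra.
apply: le_trans yp _.
have pxp : inner p (x - p) = 0.
  apply: cabs_eq0; apply: le_all_eq0 (cabs_ge0 _) _ => e e0.
  have x1 : 0 < nrm (x - p) + 1 by rewrite ltr_wpDl ?nrm_ge0.
  have [q Gq [q1 _]] := pG _ (divr_gt0 e0 x1).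
  rewrite -[inner _ _]subr0 -(pO _ Gq) -innerBl.
  apply: le_trans (cauchy_schwarz _ _) _; move: q1; rewrite ltr_pdivlMr// => h.
  by apply: le_trans (ltW h); rewrite ler_wpM2l ?nrm_ge0// lerDl.
apply: ler_of_sqr; first exact: nrm_ge0.
have := nrm_sqrD p (x - p); rewrite addrC subrK pxp /= mulr0 addr0 => ->.
by rewrite lerDl sqr_ge0.
Qed.

Lemma closure_graph_total G x : linear_graph G ->
  (forall q, G q -> nrm q.2 <= nrm q.1) -> exists y, in_closure_graph G x y.
Proof.
move=> [G0 Gl] Gle.
have Dsub : is_subspace [set q.1 | q in G].
  split; first by exists 0.
  by move=> k _ _ [q Gq <-] [r Gr <-]; exists (k *: q + r) => //; apply: Gl.
have [p [pG pO]] := projection x Dsub.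
have pO' q : G q -> inner q.1 (x - p) = 0 by move=> Gq; apply: pO; exists q.
have /choice[q qP] n : exists q, G q /\ nrm (p - q.1) < n.+1%:R^-1.
  have n0 : 0 < n.+1%:R^-1 :> R by rewrite invr_gt0.
  by have [_ [q Gq <-] qn] := pG _ n0; exists q.
have GB r t : G r -> G t -> G (r - t).
  by move=> Gr Gt; rewrite addrC -scaleN1r; apply: Gl.
have [y yP] : exists l, seq_cvg (fun n => (q n).2) l.
  apply: cauchy_seq_cvg => e e0.
  have [N NP] := inv_succ_lt (divr_gt0 e0 (ltr0Sn R 1)).
  exists N => m n Nm Nn.
  have [Gm qm] := qP m; have [Gn qn] := qP n.
  apply: le_lt_trans (Gle _ (GB _ _ Gm Gn)) _ => /=.
  apply: le_lt_trans (nrm_tri _ p _) _; rewrite (nrmB _ p) (splitr e).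
  by rewrite ltrD//; [apply: lt_trans qm _ | apply: lt_trans qn _]; apply: NP.
exists y, p; split => // e e0.
have [N1 h1] := inv_succ_lt e0; have [N2 h2] := yP _ e0.
pose n := maxn N1 N2; have [Gn qn] := qP n; exists (q n) => //.
by split; [apply: lt_trans qn (h1 _ (leq_maxl _ _)) | apply: h2 (leq_maxr _ _)].
Qed.

Lemma contraction_extension G : linear_graph G ->
  (forall q, G q -> nrm q.2 <= nrm q.1) ->
  exists v : H -> H, [/\ linear v, norm_bound v 1, (forall q, G q -> v q.1 = q.2) &
    (forall x, in_closure_graph G x (v x)) /\
    forall x y, in_closure_graph G x y -> v x = y].
Proof.
move=> Glin Gle.
have /choice[v vP] x := closure_graph_total x Glin Gle.
have vU x y : in_closure_graph G x y -> v x = y.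
  move=> xy; have := closure_graph_linear (-1) Glin xy (vP x).
  rewrite !scaleN1r addNr => /(closure_graph_bound Glin Gle); rewrite nrm0 => y0.
  have /nrm_eq0/eqP : nrm (- y + v x) = 0 by apply: le_anti; rewrite y0 nrm_ge0.
  by rewrite addrC subr_eq0 => /eqP.
exists v; split => //.
- by move=> k x y; apply/vU/closure_graph_linear.
- by move=> x; rewrite mul1r; apply: closure_graph_bound (vP x).
- move=> q Gq; apply: vU; exists q.1; split; first by move=> r _; rewrite subrr inner0r.
  by move=> e e0; exists q => //; rewrite !subrr nrm0.
Qed.

End Extension.

Section HaagImpliesUhlmann.
Variables (R : realType) (H : hilbertType R).
Implicit Types (x y z Phi Psi : H) (a b c k u v : H -> H) (M MA MB : set (H -> H)).

(** a Phi |-> a Psi is isometric because |a Phi|^2 = <Phi, a* a Phi> depends only on the state.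
    Elements of [M] preserve the domain and, through their adjoints, its orthogonal complement, so
    they commute with the extension. *)
Lemma commutant_transition M Phi Psi : star_subalgebra M ->
  (forall a, M a -> inner Psi (a Psi) = inner Phi (a Phi)) ->
  exists v, [/\ commutant M v, norm_bound v 1 & v Phi = Psi].
Proof.
move=> sM st.
pose G := [set q : H * H | exists2 a, M a & q = (a Phi, a Psi)].
have M0 : M (fun=> 0).
  have -> : (fun=> 0) = (0 : R[i]) \*: (@id H) by apply/funext => x /=; rewrite scale0r.
  exact: (star_scale sM 0 (star_unit sM)).
have Glin : linear_graph G.
  split; first by exists (fun=> 0).
  move=> k _ _ [a Ma ->] [b Mb ->]; exists (k \*: a \+ b) => //.
  exact/(star_add sM)/Mb/(star_scale sM).
have Gle q : G q -> nrm q.2 <= nrm q.1.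
  move=> [a Ma ->] /=; have [b Mb ab] := star_adj sM Ma.
  have /(congr1 (@complex.Re R)) := st _ (star_mul sM Mb Ma).
  rewrite /= !(adjoint_sym ab) !innerxx /= => e.
  by apply: ler_of_sqr; rewrite ?nrm_ge0// e.
have [v [vl v1 vG [vP vU]]] := contraction_extension Glin Gle.
exists v; split => //; last by apply: (vG (Phi, Psi)); exists id => //; apply: star_unit.
apply: commutantI; first exact: (boundedI vl v1).
move=> b x Mb; have [b' Mb' bb'] := star_adj sM Mb.
have bl := star_sub sM Mb; have [C C0 bC] := bounded_norm bl.
apply: vU; have [p [pO pG]] := vP x; exists (b p); split.
  move=> _ [a Ma ->] /=; rewrite -(linB _ _ bl.1) bb'.
  by apply: (pO ((b' \o a) Phi, (b' \o a) Psi)); exists (b' \o a) => //; apply: star_mul.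
move=> e e0; have C1 : 0 < C + 1 by rewrite ltr_wpDl.
have [_ [a Ma ->] /= [q1 q2]] := pG _ (divr_gt0 e0 C1).
exists ((b \o a) Phi, (b \o a) Psi); first by exists (b \o a) => //; apply: star_mul.
have le (u w : H) : nrm (u - w) < e / (C + 1) -> nrm (b u - b w) < e.
  rewrite ltr_pdivlMr// -(linB _ _ bl.1); apply: le_lt_trans.
  apply: le_trans (bC _) _.
  by rewrite mulrC ler_wpM2l ?nrm_ge0// lerDl.
by split; apply: le.
Qed.

Lemma haag_uhlmann MA MB : von_neumann_algebra MA ->
  haag_duality MA MB -> uhlmann_property MA MB.
Proof.
move=> [sA _] -> Phi Psi; rewrite !nrmE => /complexI Phi1 /complexI Psi1 st e e0.
have [v [vA v1 vPhi]] := commutant_transition sA st.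
have [u [uA uu ule]] :=
  contraction_le_unitaries (star_sub sA) (star_adj sA) vA v1 Phi1 Psi1 e0.
exists u; split => //; rewrite cabsE -rmorphB/= lecR.
apply: le_trans (Re_le_cabs _); apply: le_trans ule.
by rewrite vPhi innerxx Psi1 expr1n.
Qed.

End HaagImpliesUhlmann.

(** * Unconditional sums *)

#[local] Existing Instance totally_filter.

Section Sums.
Variables (R : realType).

Section NonnegativeSums.
Variables (I : choiceType).
Implicit Types (f g : I -> R) (s t : seq I).

Definition nsummable f := exists M : R, forall s, uniq s -> \sum_(i <- s) f i <= M.

(** For an unbounded set [sup] is a default value, so [nsum f] has its meaning only together with
    [nsummable f]. *)
Definition nsum f : R := sup [set r | exists2 s, uniq s & r = \sum_(i <- s) f i].

Lemma nsum_has_sup f : nsummable f ->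
  has_sup [set r | exists2 s, uniq s & r = \sum_(i <- s) f i].
Proof.
by move=> [M fM]; split; [exists 0, [::]; rewrite ?big_nil | exists M => _ [s us ->]; apply: fM].
Qed.

Lemma nsum_ub f s : nsummable f -> uniq s -> \sum_(i <- s) f i <= nsum f.
Proof. by move=> /nsum_has_sup[_ fb] us; apply: sup_ubound => //; exists s. Qed.

Lemma nsum_le f (M : R) : (forall s, uniq s -> \sum_(i <- s) f i <= M) -> nsum f <= M.
Proof.
move=> fM; apply: ge_sup; first by exists 0, [::]; rewrite ?big_nil.
by move=> _ [s us ->]; apply: fM.
Qed.

Lemma nsum_adherent f (e : R) : nsummable f -> 0 < e ->
  exists2 s, uniq s & nsum f - e < \sum_(i <- s) f i.
Proof.
by move=> /nsum_has_sup fs e0; have [_ [s us ->] ?] := sup_adherent e0 fs; exists s.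
Qed.

Lemma nsum_ge0 f : nsummable f -> 0 <= nsum f.
Proof. by move=> fs; have := @nsum_ub f [::] fs isT; rewrite big_nil. Qed.

Lemma sum_subset (V : zmodType) (f : I -> V) s t : uniq s -> uniq t ->
  {subset s <= t} ->
  \sum_(i <- t) f i = \sum_(i <- s) f i + \sum_(i <- t | i \notin s) f i.
Proof.
move=> us ut st; rewrite (bigID (mem s))/=; congr (_ + _).
rewrite -big_filter; apply: perm_big; apply: uniq_perm => //.
  exact: filter_uniq.
by move=> i; rewrite mem_filter; case: (boolP (i \in s)) => //= /st.
Qed.

Lemma sum_le_subset f s t : (forall i, 0 <= f i) -> uniq s -> uniq t ->
  {subset s <= t} -> \sum_(i <- s) f i <= \sum_(i <- t) f i.
Proof. by move=> f0 us ut st; rewrite (sum_subset f us ut st) lerDl sumr_ge0. Qed.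

Lemma nsummable_le f g : (forall i, f i <= g i) -> nsummable g -> nsummable f.
Proof.
by move=> fg [M gM]; exists M => s us; apply: le_trans (gM s us); apply: ler_sum.
Qed.

Lemma nsummableZ f (C : R) : 0 <= C -> nsummable f -> nsummable (fun i => C * f i).
Proof. by move=> C0 [M fM]; exists (C * M) => s us; rewrite -mulr_sumr ler_wpM2l// fM. Qed.

End NonnegativeSums.

(** One half of Tonelli's theorem; the other half is the same statement for the transposed
    family. *)
Lemma nsum_swap_le (I J : choiceType) (f : I -> J -> R) :
  (forall i j, 0 <= f i j) -> (forall i, nsummable (f i)) ->
  nsummable (fun i => nsum (f i)) ->
  [/\ forall j, nsummable (f ^~ j), nsummable (fun j => nsum (f ^~ j)) &
      nsum (fun j => nsum (f ^~ j)) <= nsum (fun i => nsum (f i))].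
Proof.
move=> f0 fi fs; set N := nsum (fun i => nsum (f i)).
have fin s t : uniq s -> uniq t -> \sum_(j <- t) \sum_(i <- s) f i j <= N.
  move=> us ut; rewrite exchange_big/=; apply: le_trans (nsum_ub fs us).
  by apply: ler_sum => i _; apply: nsum_ub.
have col j : nsummable (f ^~ j).
  by exists N => s us; have := fin s [:: j] us isT; rewrite big_seq1.
have bd t : uniq t -> \sum_(j <- t) nsum (f ^~ j) <= N.
  move=> ut; apply/ler_addgt0Pr => e e0.
  (* The total error e is shared among the columns in t; the successor avoids division by zero. One
     finite set of rows then serves all these columns. *)
  pose d := e / (size t).+1%:R.
  have d0 : 0 < d by rewrite divr_gt0.
  have /choice[s sP] j : exists s, uniq s /\ nsum (f ^~ j) - d < \sum_(i <- s) f i j.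
    by have [s us ?] := nsum_adherent (col j) d0; exists s.
  pose S := undup (flatten [seq s j | j <- t]).
  have le j : j \in t -> nsum (f ^~ j) <= \sum_(i <- S) f i j + d.
    move=> jt; have [us h] := sP j; rewrite -lerBlDr; apply: le_trans (ltW h) _.
    apply: sum_le_subset => //; first exact: undup_uniq.
    by move=> i ij; rewrite mem_undup; apply/flattenP; exists (s j) => //; apply: map_f.
  apply: (@le_trans _ _ (\sum_(j <- t) (\sum_(i <- S) f i j + d))).
    by rewrite big_seq [leRHS]big_seq; apply: ler_sum.
  rewrite big_split/= lerD ?fin ?undup_uniq//.
  rewrite big_const_seq count_predT iter_addr_0 -[d *+ _]mulr_natr /d.
  rewrite mulrAC ler_pdivrMr// ler_wpM2l ?(ltW e0)// ler_nat//.
split => //; first by exists N.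
exact: nsum_le.
Qed.

Lemma nsum_swap (I J : choiceType) (f : I -> J -> R) :
  (forall i j, 0 <= f i j) -> (forall i, nsummable (f i)) ->
  nsummable (fun i => nsum (f i)) ->
  [/\ forall j, nsummable (f ^~ j), nsummable (fun j => nsum (f ^~ j)) &
      nsum (fun j => nsum (f ^~ j)) = nsum (fun i => nsum (f i))].
Proof.
move=> f0 fi fs; have [cj cs le] := nsum_swap_le f0 fi fs; split => //.
have [_ _ ge] := @nsum_swap_le J I (fun j i => f i j) (fun j i => f0 i j) cj cs.
by apply/eqP; rewrite eq_le le.
Qed.

Section ComplexSums.
Variables (I : choiceType).
Implicit Types (f g : I -> R[i]) (s t : seq I) (z w : R[i]).

(* Unconditional convergence, tested on duplicate-free lists of indices. *)
Definition csum f z := forall e : R, 0 < e -> exists s, forall t, uniq t ->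
  {subset s <= t} -> cabs (\sum_(i <- t) f i - z) < e.

Lemma csum_has_sum f z : csum f z -> has_sum f z.
Proof.
move=> fz; apply/(@cvgrPdist_lt R[i] R[i]^o) => eps; rewrite ltcE/= => /andP[/eqP ime e0].
have [s sP] := fz _ e0.
exists [fset i in s]%fset => // A /= sA.
rewrite /partial_sum -(big_seq_fsetE _ _ xpredT)/= distrC cabsE ltcE/= ime eqxx/=.
apply: sP => [|i si]; first exact: fset_uniq.
by apply: (fsubsetP sA); rewrite inE.
Qed.

Lemma has_sum_csum f z : has_sum f z -> csum f z.
Proof.
move=> /(@cvgrPdist_lt R[i] R[i]^o) fz e e0.
have [|A _ AP] := fz e%:C; first by rewrite ltcR.
exists A => t ut At; have /(_ [fset i in t]%fset) := AP.
rewrite /= distrC cabsE ltcR /partial_sum -(big_seq_fsetE _ _ xpredT)/=.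
rewrite (perm_big t)/=; first apply.
  by apply/fsubsetP => i; rewrite inE => /At.
by apply: uniq_perm => // i; rewrite inE.
Qed.

Lemma csum_ext f g z w : csum f z -> f =1 g -> z = w -> csum g w.
Proof. by move=> fz /funext <- <-. Qed.

Lemma csum_unique f z w : csum f z -> csum f w -> z = w.
Proof.
move=> fz fw; apply/eqP; rewrite -subr_eq0; apply/eqP/cabs_eq0.
apply: le_all_eq0 (cabs_ge0 _) _ => e e0.
have e2 : 0 < e / 2 by rewrite divr_gt0.
have [s1 h1] := fz _ e2; have [s2 h2] := fw _ e2.
pose t := undup (s1 ++ s2).
have {}h1 : cabs (\sum_(i <- t) f i - z) < e / 2.
  by apply: h1; rewrite ?undup_uniq// => i si; rewrite mem_undup mem_cat si.
have {}h2 : cabs (\sum_(i <- t) f i - w) < e / 2.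
  by apply: h2; rewrite ?undup_uniq// => i si; rewrite mem_undup mem_cat si orbT.
have -> : z - w = - (\sum_(i <- t) f i - z) + (\sum_(i <- t) f i - w) by ring.
rewrite (splitr e); apply: le_trans (cabsD _ _) (lerD _ _); last exact: ltW.
by rewrite cabsN ltW.
Qed.

Lemma csumD f g z w : csum f z -> csum g w -> csum (fun i => f i + g i) (z + w).
Proof.
move=> fz gw e e0.
have e2 : 0 < e / 2 by rewrite divr_gt0.
have [s1 h1] := fz _ e2; have [s2 h2] := gw _ e2.
exists (s1 ++ s2) => t ut st.
have {}h1 : cabs (\sum_(i <- t) f i - z) < e / 2.
  by apply: h1 => // i si; apply: st; rewrite mem_cat si.
have {}h2 : cabs (\sum_(i <- t) g i - w) < e / 2.
  by apply: h2 => // i si; apply: st; rewrite mem_cat si orbT.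
rewrite big_split/= opprD addrACA (splitr e); apply: le_lt_trans (cabsD _ _) _.
exact: ltrD.
Qed.

Lemma csumZ (l : R[i]) f z : csum f z -> csum (fun i => l * f i) (l * z).
Proof.
move=> fz e e0; have l1 : 0 < cabs l + 1 by rewrite ltr_wpDl ?cabs_ge0.
have [s sP] := fz _ (divr_gt0 e0 l1); exists s => t ut st.
have := sP t ut st; rewrite ltr_pdivlMr// => h.
rewrite -mulr_sumr -mulrBr cabsM; apply: le_lt_trans h.
by rewrite mulrC ler_wpM2l ?cabs_ge0// lerDl.
Qed.

Lemma csum_conj f z : csum f z -> csum (fun i => cj (f i)) (cj z).
Proof.
move=> fz e /fz[s sP]; exists s => t ut st.
have -> : \sum_(i <- t) cj (f i) = cj (\sum_(i <- t) f i) by rewrite rmorph_sum.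
by rewrite -rmorphB cabs_conj sP.
Qed.

Lemma csum_nsum (f : I -> R) : (forall i, 0 <= f i) -> nsummable f ->
  csum (fun i => (f i)%:C) (nsum f)%:C.
Proof.
move=> f0 fs e e0; have [s us se] := nsum_adherent fs e0; exists s => t ut st.
rewrite -rmorph_sum -rmorphB/= cabs_real.
have := sum_le_subset f0 us ut st; have := nsum_ub fs ut => h1 h2.
by rewrite ler0_norm ?subr_le0// opprB; lra.
Qed.

Lemma csum_nonneg (f : I -> R) z : (forall i, 0 <= f i) ->
  csum (fun i => (f i)%:C) z -> nsummable f /\ z = (nsum f)%:C.
Proof.
move=> f0 fz.
have fs : nsummable f.
  have [s sP] := fz 1 ltr01; exists (cabs z + 1) => t ut.
  pose u := undup (s ++ t).
  have uu : uniq u := undup_uniq _.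
  apply: le_trans (sum_le_subset f0 ut uu _) _.
    by move=> i it; rewrite mem_undup mem_cat it orbT.
  have := sP u uu; rewrite -rmorph_sum/= => h.
  have {}h : cabs ((\sum_(i <- u) f i)%:C - z) < 1.
    by apply: h => i si; rewrite mem_undup mem_cat si.
  have := cabsD ((\sum_(i <- u) f i)%:C - z) z; rewrite subrK cabs_real => h2.
  by apply: le_trans (ler_norm _) _; lra.
by split => //; apply: csum_unique fz (csum_nsum f0 fs).
Qed.

End ComplexSums.

Lemma csum_sumtype (I J : choiceType) (f : I + J -> R[i]) z w :
  csum (f \o inl) z -> csum (f \o inr) w -> csum f (z + w).
Proof.
move=> fz fw e e0.
have e2 : 0 < e / 2 by rewrite divr_gt0.
have [s1 h1] := fz _ e2; have [s2 h2] := fw _ e2.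
exists (map inl s1 ++ map inr s2) => t ut st.
pose getl (k : I + J) := if k is inl i then Some i else None.
pose getr (k : I + J) := if k is inr i then Some i else None.
have il i : (i \in pmap getl t) = (inl i \in t).
  rewrite mem_pmap; apply/mapP/idP => [[[k|k] kt //= [->]] //|it].
  by exists (inl i).
have ir i : (i \in pmap getr t) = (inr i \in t).
  rewrite mem_pmap; apply/mapP/idP => [[[k|k] kt //= [->]] //|it].
  by exists (inr i).
have ul : uniq (pmap getl t).
  by apply: (pmap_uniq (g := inl)) => // -[].
have ur : uniq (pmap getr t).
  by apply: (pmap_uniq (g := inr)) => // -[].
have -> : \sum_(k <- t) f k =
    \sum_(i <- pmap getl t) (f \o inl) i + \sum_(j <- pmap getr t) (f \o inr) j.
  rewrite -(big_map inl xpredT f) -(big_map inr xpredT f) -big_cat/=.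
  apply: perm_big; apply: uniq_perm => //.
    rewrite cat_uniq !map_inj_uniq ?ul ?ur//=; try by move=> ? ? [].
    by rewrite andbT; apply/hasPn => _ /mapP[j _ ->]; apply/mapP => -[].
  move=> [i|j]; rewrite mem_cat.
    rewrite mem_map ?il; last by move=> ? ? [].
    by case: (boolP (inl i \in t)) => //= _; apply/esym/mapP => -[].
  rewrite orbC mem_map ?ir; last by move=> ? ? [].
  by case: (boolP (inr j \in t)) => //= _; apply/esym/mapP => -[].
rewrite opprD addrACA (splitr e); apply: le_lt_trans (cabsD _ _) _.
apply: ltrD.
  apply: h1 => // i si; rewrite il; apply: st.
  by rewrite mem_cat map_f.
apply: h2 => // i si; rewrite ir; apply: st.
by rewrite mem_cat map_f ?orbT.
Qed.

End Sums.

Section PolarizedSums.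
Variables (R : realType).

Definition unit_phases : seq R[i] := [:: 1; -1; ci; - ci].

(* By polarization, sums of inner products are governed by the four sums
   of squared norms. *)
Definition polar_sums (I : choiceType) (V : hilbertType R) (a b : I -> V) (q : R[i] -> R) :=
  forall l, l \in unit_phases ->
    nsummable (fun i => nrm (a i + l *: b i) ^+ 2) /\
    nsum (fun i => nrm (a i + l *: b i) ^+ 2) = q l.

Definition polar_value (q : R[i] -> R) : R[i] :=
  4%:R^-1 * ((q 1)%:C - (q (-1))%:C - ci * (q ci)%:C + ci * (q (- ci))%:C).

Lemma polar_csum (I : choiceType) (V : hilbertType R) (a b : I -> V) q :
  polar_sums a b q -> csum (fun i => inner (a i) (b i)) (polar_value q).
Proof.
move=> ab.
have sq l : l \in unit_phases ->
    csum (fun i => (nrm (a i + l *: b i) ^+ 2)%:C) (q l)%:C.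
  by move=> /ab[s1 <-]; apply: csum_nsum => // i; rewrite sqr_ge0.
have := csumZ 4%:R^-1 (csumD (csumD (csumD (sq 1 _) (csumZ (-1) (sq (-1) _)))
  (csumZ (- ci) (sq ci _))) (csumZ ci (sq (- ci) _))).
rewrite !inE !eqxx ?orbT => /(_ isT isT isT isT).
move=> h; apply: (csum_ext h) => [i|]; last by rewrite /polar_value; ring.
have four0 : 4%:R != 0 :> R[i] by rewrite pnatr_eq0.
apply: (mulfI four0); rewrite mulVKf// polarization.
rewrite scale1r scaleN1r scaleNr -!innerxx; ring.
Qed.

End PolarizedSums.

(** * Square summable families *)

Lemma nsumZ (R : realType) (I : choiceType) (f : I -> R) (C : R) : 0 <= C ->
  (forall i, 0 <= f i) -> nsummable f -> nsum (fun i => C * f i) = C * nsum f.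
Proof.
move=> C0 f0 fs; apply: complexI; rewrite rmorphM/=.
have Cf i : 0 <= C * f i by rewrite mulr_ge0.
have h := csumZ C%:C (csum_nsum f0 fs).
apply: csum_unique (csum_nsum Cf (nsummableZ C0 fs)) _.
by apply: csum_ext h _ _ => // i; rewrite rmorphM.
Qed.

(** Termwise (a + b)^2 <= (1 + G/F) a^2 + (1 + F/G) b^2, which is (G a - F b)^2 >= 0. The weights
    are those for which the bounds F^2 and G^2 add up to (F + G)^2. *)
Lemma minkowski_pos (R : realType) (I : Type) (s : seq I) (a b : I -> R) (F G : R) :
  0 < F -> 0 < G ->
  \sum_(i <- s) a i ^+ 2 <= F ^+ 2 -> \sum_(i <- s) b i ^+ 2 <= G ^+ 2 ->
  \sum_(i <- s) (a i + b i) ^+ 2 <= (F + G) ^+ 2.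
Proof.
move=> F0 G0 aF bG.
have le i : (a i + b i) ^+ 2 <= (1 + G / F) * a i ^+ 2 + (1 + F / G) * b i ^+ 2.
  rewrite -subr_ge0 (_ : _ - _ = (G * a i - F * b i) ^+ 2 / (F * G)).
    by rewrite divr_ge0 ?sqr_ge0// mulr_ge0 ?ltW.
  by field; rewrite !gt_eqF.
apply: (@le_trans _ _ (\sum_(i <- s) ((1 + G / F) * a i ^+ 2 + (1 + F / G) * b i ^+ 2))).
  by apply: ler_sum.
rewrite big_split/= -!mulr_sumr.
have -> : (F + G) ^+ 2 = (1 + G / F) * F ^+ 2 + (1 + F / G) * G ^+ 2.
  by field; rewrite !gt_eqF.
by rewrite lerD// ler_wpM2l// addr_ge0// divr_ge0// ltW.
Qed.

Section L2.
Variables (R : realType) (I : choiceType) (V : hilbertType R).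

Definition l2_pred : {pred I -> V} :=
  fun f => `[< nsummable (fun i => nrm (f i) ^+ 2) >].

Lemma l2_submod : submod_closed l2_pred.
Proof.
split.
  apply/asboolP; exists 0 => s _.
  by rewrite big1// => i _; rewrite nrm0 expr0n.
move=> k f g /asboolP[M fM] /asboolP[N gN]; apply/asboolP.
exists (2 * cabs k ^+ 2 * M + 2 * N) => s us.
apply: (@le_trans _ _ (\sum_(i <- s)
    (2 * cabs k ^+ 2 * nrm (f i) ^+ 2 + 2 * nrm (g i) ^+ 2))).
  apply: ler_sum => i _; have := parallelogram (k *: f i) (g i).
  rewrite nrmZ exprMn mulrA => <-.
  by rewrite lerDl sqr_ge0.
rewrite big_split/= -!mulr_sumr lerD// ler_wpM2l ?fM ?gN//.
by rewrite mulr_ge0 ?sqr_ge0.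
Qed.

HB.instance Definition _ := GRing.isSubmodClosed.Build _ _ l2_pred l2_submod.

Record l2 := L2 { l2val :> I -> V ; l2P : l2val \in l2_pred }.

HB.instance Definition _ := [isSub for l2val].
HB.instance Definition _ := [Choice of l2 by <:].
HB.instance Definition _ := [SubChoice_isSubLmodule of l2 by <:].

Implicit Types f g : l2.

Lemma l2_eq f g : (forall i, f i = g i) -> f = g.
Proof. by move=> fg; apply/val_inj/funext. Qed.

Lemma l2D f g i : (f + g) i = f i + g i. Proof. by []. Qed.
Lemma l2Z (k : R[i]) f i : (k *: f) i = k *: f i. Proof. by []. Qed.
Lemma l2B f g i : (f - g) i = f i - g i. Proof. by []. Qed.
Lemma l2_summable f : nsummable (fun i => nrm (f i) ^+ 2).
Proof. exact/asboolP/l2P. Qed.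

Definition l2n f : R := Num.sqrt (nsum (fun i => nrm (f i) ^+ 2)).

Lemma l2n_ge0 f : 0 <= l2n f. Proof. exact: sqrtr_ge0. Qed.

Lemma l2n_sqr f : l2n f ^+ 2 = nsum (fun i => nrm (f i) ^+ 2).
Proof. by rewrite sqr_sqrtr// nsum_ge0//; apply: l2_summable. Qed.

Lemma l2n_ub f s : uniq s -> \sum_(i <- s) nrm (f i) ^+ 2 <= l2n f ^+ 2.
Proof. by move=> us; rewrite l2n_sqr nsum_ub//; apply: l2_summable. Qed.

Lemma l2n_le f (M : R) : 0 <= M ->
  (forall s, uniq s -> \sum_(i <- s) nrm (f i) ^+ 2 <= M ^+ 2) -> l2n f <= M.
Proof. by move=> M0 fM; apply: ler_of_sqr => //; rewrite l2n_sqr nsum_le. Qed.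

Lemma nrm_le_l2n f i : nrm (f i) <= l2n f.
Proof.
apply: ler_of_sqr; first exact: l2n_ge0.
by have := @l2n_ub f [:: i] isT; rewrite big_seq1.
Qed.

Lemma l2nD f g : l2n (f + g) <= l2n f + l2n g.
Proof.
apply/ler_addgt0Pr => e e0; have e2 : 0 < e / 2 by rewrite divr_gt0.
have f0 := l2n_ge0 f; have g0 := l2n_ge0 g.
have fe : 0 < l2n f + e / 2 by rewrite ltr_wpDl.
have ge : 0 < l2n g + e / 2 by rewrite ltr_wpDl.
have -> : l2n f + l2n g + e = (l2n f + e / 2) + (l2n g + e / 2) by field.
apply: l2n_le => [|s us]; first by rewrite addr_ge0// ltW.
apply: (@le_trans _ _ (\sum_(i <- s) (nrm (f i) + nrm (g i)) ^+ 2)).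
  apply: ler_sum => i _; rewrite ler_pXn2r// ?nnegrE ?nrm_ge0 ?nrmD//.
  by rewrite addr_ge0 ?nrm_ge0.
apply: minkowski_pos => //; apply: le_trans (l2n_ub _ us) _;
  by rewrite ler_pXn2r// ?nnegrE ?ltW// ltrDl.
Qed.

Lemma l2nZ (k : R[i]) f : l2n (k *: f) = cabs k * l2n f.
Proof.
have := nsumZ (sqr_ge0 (cabs k)) (fun i => sqr_ge0 (nrm (f i))) (l2_summable f).
rewrite -l2n_sqr -exprMn => h; apply/eqP.
rewrite -(@eqrXn2 _ 2) ?mulr_ge0 ?cabs_ge0 ?l2n_ge0// -h l2n_sqr.
by apply/eqP; congr nsum; apply/funext => i; rewrite l2Z nrmZ exprMn.
Qed.

Lemma l2n_eq0 f : l2n f = 0 -> f = 0.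
Proof.
move=> f0; apply: l2_eq => i; apply: nrm_eq0; apply: le_anti.
by rewrite nrm_ge0 andbT -f0 nrm_le_l2n.
Qed.

Lemma l2_normD f g : (l2n (f + g))%:C <= (l2n f)%:C + (l2n g)%:C.
Proof. by rewrite -rmorphD/= lecR l2nD. Qed.

Lemma l2_normZ (k : R[i]) f : (l2n (k *: f))%:C = `|k| * (l2n f)%:C.
Proof. by rewrite l2nZ rmorphM/= cabsE. Qed.

Lemma l2_norm_eq0 f : (l2n f)%:C = 0 -> f = 0.
Proof. by move=> /complexI/l2n_eq0. Qed.

HB.instance Definition _ :=
  Lmodule_isNormed.Build R[i] l2 l2_normD l2_normZ l2_norm_eq0.

Lemma l2_normE f : `|f| = (l2n f)%:C.
Proof. by []. Qed.

Lemma l2_complete (F : set_system l2) : ProperFilter F -> cauchy F -> cvg F.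
Proof.
move=> FF /cauchyP FC.
have {}FC (e : R) : 0 < e -> exists x : l2, F [set y | l2n (x - y) < e].
  move=> e0; have [|x Fx] := FC e%:C; first by rewrite ltcR.
  by exists x; apply: filterS Fx => y; rewrite -ball_normE/= l2_normE ltcR.
have /choice[g gP] i : exists l : V, forall e : R, 0 < e ->
    F [set y | nrm (l - l2val y i) < e].
  have : cauchy ((fun f : l2 => f i) @ F).
    apply/cauchy_exP => eps; rewrite ltcE/= => /andP[/eqP ime e0].
    have [x Fx] := FC _ e0; exists (x i); apply: filterS Fx => y /= xy.
    rewrite -ball_normE/= nrmE ltcE/= ime eqxx/= -l2B.
    exact: le_lt_trans (nrm_le_l2n _ _) xy.
  move=> /cauchy_cvg/cvg_ex[l Fl]; exists l => e e0.
  have /cvgrPdist_lt/(_ e%:C) := Fl; rewrite ltcR => /(_ e0).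
  by apply: filterS => y; rewrite nrmE ltcR.
have fin (e : R) (s : seq I) : 0 < e ->
    F [set y | forall i, i \in s -> nrm (g i - l2val y i) < e].
  move=> e0; elim: s => [|i s IH].
    by apply: filterS filterT => y _ i; rewrite in_nil.
  apply: filterS2 (gP i e e0) IH => y yi ys j.
  by rewrite inE => /predU1P[-> //|]; apply: ys.
(* On a finite set of indices, compare g with x through a y of the filter that is close to x in norm
   and to g at each index: the two errors are at most e each. *)
have close (e : R) (x : l2) : 0 < e -> F [set y | l2n (x - y) < e] ->
    forall s, uniq s -> \sum_(i <- s) nrm (g i - x i) ^+ 2 <= (e + e) ^+ 2.
  move=> e0 Fx s us.
  have d0 : 0 < e / (size s).+1%:R by rewrite divr_gt0.
  have [y [yx yg]] := filter_ex (filterI Fx (fin _ s d0)).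
  apply: (@le_trans _ _ (\sum_(i <- s) (nrm (g i - y i) + nrm ((x - y) i)) ^+ 2)).
    apply: ler_sum => i _; rewrite ler_pXn2r// ?nnegrE ?nrm_ge0//; last first.
      by rewrite addr_ge0 ?nrm_ge0.
    by rewrite l2B (nrmB (x i)) nrm_tri.
  apply: minkowski_pos => //; last first.
    by apply: le_trans (l2n_ub _ us) _; rewrite ler_pXn2r// ?nnegrE ?l2n_ge0 ?ltW.
  apply: (@le_trans _ _ (\sum_(i <- s) (e / (size s).+1%:R) ^+ 2)).
    rewrite big_seq [leRHS]big_seq; apply: ler_sum => i si.
    by rewrite ler_pXn2r// ?nnegrE ?nrm_ge0 ?(ltW d0)// ltW// yg.
  rewrite big_const_seq count_predT iter_addr_0 -[_ *+ _]mulr_natr expr_div_n.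
  rewrite mulrAC ler_pdivrMr ?exprn_gt0// ler_wpM2l ?sqr_ge0//.
  by rewrite -natrX ler_nat expnS expn1 (leq_trans (leqnSn _))// leq_pmulr.
have gl2 : g \in l2_pred.
  have [x Fx] := FC 1 ltr01.
  rewrite (_ : g = (g \- l2val x) + l2val x); last by apply/funext => i /=; rewrite subrK.
  apply: rpredD; last exact: l2P.
  by apply/asboolP; exists ((1 + 1) ^+ 2); apply: close Fx.
apply/cvg_ex; exists (L2 gl2); apply/fcvgrPdist_lt => eps.
rewrite ltcE/= => /andP[/eqP ime e0].
have e4 : 0 < complex.Re eps / 4 by rewrite divr_gt0.
have [x Fx] := FC _ e4; apply: filterS (Fx) => y /= xy.
rewrite l2_normE ltcE/= ime eqxx/=.
have gx : l2n (L2 gl2 - x) <= complex.Re eps / 4 + complex.Re eps / 4.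
  by apply: l2n_le; [rewrite addr_ge0// ltW | apply: close].
have -> : L2 gl2 - y = (L2 gl2 - x) + (x - y) by rewrite addrA subrK.
by apply: le_lt_trans (l2nD _ _) _; lra.
Qed.

HB.instance Definition _ := Uniform_isComplete.Build l2 l2_complete.

(** Polarization makes this a total function built from norms. Its algebraic properties then follow
    from [l2_inner_csum] and the uniqueness of unconditional sums. *)
Definition l2_inner f g : R[i] :=
  polar_value (fun l => nsum (fun i => nrm (f i + l *: g i) ^+ 2)).

Lemma l2_inner_csum f g : csum (fun i => inner (f i) (g i)) (l2_inner f g).
Proof. by apply: polar_csum => l _; split => //; apply: (l2_summable (f + l *: g)). Qed.

Definition l2_dot f g := l2_inner g f.

Lemma l2_dot_csum f g : csum (fun i => inner (g i) (f i)) (l2_dot f g).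
Proof. exact: l2_inner_csum. Qed.

Lemma l2_dot_linearl h (k : R[i]) f g :
  l2_dot (k *: f + g) h = k * l2_dot f h + l2_dot g h.
Proof.
apply: csum_unique (l2_dot_csum _ _) _.
apply: csum_ext (csumD (csumZ k (l2_dot_csum f h)) (l2_dot_csum g h)) _ _ => // i.
by rewrite l2D l2Z innerDr innerZr.
Qed.

Lemma l2_dotC f g : l2_dot f g = cj (l2_dot g f).
Proof.
apply: csum_unique (l2_dot_csum _ _) _.
by apply: csum_ext (csum_conj (l2_dot_csum g f)) _ _ => // i; rewrite -innerC.
Qed.

Lemma l2_dotxx f : l2_dot f f = (l2n f ^+ 2)%:C.
Proof.
apply: csum_unique (l2_dot_csum _ _) _; rewrite l2n_sqr.
apply: csum_ext (csum_nsum (fun i => sqr_ge0 (nrm (f i))) (l2_summable f)) _ _ => // i.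
by rewrite innerxx.
Qed.

Lemma l2_dot_bilinear :
  bilinear_for (GRing.Scale.Law.clone _ _ ( *%R ) _)
    (GRing.Scale.Law.clone _ _ (Num.conj \; *%R ) _) l2_dot.
Proof.
split=> [h k f g|h k f g] /=; first exact: l2_dot_linearl.
by rewrite !(l2_dotC h) l2_dot_linearl rmorphD rmorphM.
Qed.

HB.instance Definition _ :=
  bilinear_isBilinear.Build R[i] l2 l2 R[i] _ _ l2_dot l2_dot_bilinear.

Lemma l2_dot_hermitian f g : l2_dot f g = (-1) ^+ false * Num.conj (l2_dot g f).
Proof. by rewrite expr0 mul1r l2_dotC. Qed.

HB.instance Definition _ :=
  isHermitianSesquilinear.Build R[i] l2 false Num.conj l2_dot l2_dot_hermitian.

Lemma l2_dot_gt0 f : f != 0 -> 0 < l2_dot f f.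
Proof.
move=> f0; rewrite l2_dotxx ltcR exprn_gt0// lt_def l2n_ge0 andbT.
by apply: contra_neq f0; apply: l2n_eq0.
Qed.

HB.instance Definition _ := isDotProduct.Build R[i] l2 l2_dot l2_dot_gt0.

Lemma l2_hilbert_normE f : l2_dot f f = `|f| ^+ 2.
Proof. by rewrite l2_dotxx l2_normE rmorphXn. Qed.

Definition l2_hilbert : hilbertType R := @Hilbert R l2 l2_dot l2_hilbert_normE.

End L2.

(** * The complex numbers as a Hilbert space *)

Section ScalarHilbert.
Variable R : realType.

(** A separate name to carry the completeness and inner product structures. *)
Definition scalars : Type := R[i]^o.

HB.instance Definition _ := NormedModule.copy scalars R[i]^o.

Lemma complex_complete (F : set_system scalars) : ProperFilter F -> cauchy F -> cvg F.
Proof.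
move=> FF /cauchyP FC.
have {}FC (e : R) : 0 < e -> exists x : R[i], F [set y | cabs (x - y) < e].
  move=> e0; have [|x Fx] := FC e%:C; first by rewrite ltcR.
  by exists x; apply: filterS Fx => y; rewrite -ball_normE/= cabsE ltcR.
have lim (p : R[i] -> R) : (forall x y, `|p x - p y| <= cabs (x - y)) ->
    exists l : R, forall e : R, 0 < e -> F [set y | `|l - p y| < e].
  move=> pP; have : cauchy (p @ F).
    apply/cauchy_exP => e e0; have [x Fx] := FC _ e0; exists (p x).
    change (F (p @^-1` ball (p x) e)).
    apply: filterS Fx => y /= xy; rewrite -ball_normE/=.
    exact: le_lt_trans (pP _ _) xy.
  by move=> /cauchy_cvg/cvg_ex[l /cvgrPdist_lt Fl]; exists l.
have [a aP] := lim (@complex.Re R) (fun x y =>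
  eq_ind _ (fun t => `|t| <= cabs (x - y)) (Re_le_cabs_norm (x - y)) _
    (etrans (ReD x (- y)) (congr1 (+%R (Re x)) (ReN y)))).
have [b bP] := lim (@complex.Im R) (fun x y =>
  eq_ind _ (fun t => `|t| <= cabs (x - y)) (Im_le_cabs_norm (x - y)) _
    (etrans (ImD x (- y)) (congr1 (+%R (Im x)) (ImN y)))).
apply/cvg_ex; exists (a +i* b); apply/fcvgrPdist_lt => eps.
rewrite ltcE/= => /andP[/eqP ime e0].
have e2 : 0 < complex.Re eps / 2 by rewrite divr_gt0.
apply: filterS2 (aP _ e2) (bP _ e2) => -[c d] /= ac bd.
rewrite cabsE ltcE/= ime eqxx/=.
have -> : (a +i* b) - (c +i* d) = (a - c)%:C + ci * (b - d)%:C.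
  by apply: complex_eq => /=; ring.
apply: le_lt_trans (cabsD _ _) _; rewrite cabsM cabsi mul1r !cabs_real; lra.
Qed.

HB.instance Definition _ := Uniform_isComplete.Build scalars complex_complete.

Definition scalar_dot (x y : scalars) : R[i] := x * Num.conj y.

Lemma scalar_dot_bilinear :
  bilinear_for (GRing.Scale.Law.clone _ _ ( *%R ) _)
    (GRing.Scale.Law.clone _ _ (Num.conj \; *%R ) _) scalar_dot.
Proof.
split=> h k f g; rewrite /scalar_dot /=.
  by rewrite mulrDl -mulrA.
by rewrite rmorphD rmorphM mulrDr mulrCA.
Qed.

HB.instance Definition _ := bilinear_isBilinear.Build R[i] scalars scalars R[i] _ _
  scalar_dot scalar_dot_bilinear.

Lemma scalar_dot_hermitian (x y : scalars) :
  scalar_dot x y = (-1) ^+ false * Num.conj (scalar_dot y x).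
Proof. by rewrite expr0 mul1r /scalar_dot rmorphM/= conjCK mulrC. Qed.

HB.instance Definition _ := isHermitianSesquilinear.Build R[i] scalars false Num.conj
  scalar_dot scalar_dot_hermitian.

Lemma scalar_dotxx (x : scalars) : scalar_dot x x = `|x| ^+ 2.
Proof. by rewrite /scalar_dot -sqr_normc. Qed.

Lemma scalar_dot_gt0 (x : scalars) : x != 0 -> 0 < scalar_dot x x.
Proof. by move=> x0; rewrite scalar_dotxx exprn_gt0// normr_gt0. Qed.

HB.instance Definition _ := isDotProduct.Build R[i] scalars scalar_dot scalar_dot_gt0.

Definition scalar_hilbert : hilbertType R := @Hilbert R scalars scalar_dot scalar_dotxx.

End ScalarHilbert.

(** * Orthonormal bases and traces *)

Section OrthonormalBases.
Variables (R : realType) (H : hilbertType R).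
Implicit Types (x y z : H).

(** Zorn on orthonormal sets: a nonzero vector orthogonal to a maximal one could be normalized and
    added to it. *)
Lemma onb_exists : exists (I : choiceType) (e : I -> H), orthonormal_basis e.
Proof.
pose P := [set A : set H | forall x y, A x -> A y -> inner x y = (x == y)%:R].
have [F FP Ftot|A [PA Amax]] := @Zorn_bigcup H P.
  move=> x y [X FX Xx] [Y FY Yy]; have [XY|YX] := Ftot _ _ FX FY.
    by apply: (FP _ FY) => //; apply: XY.
  by apply: (FP _ FX) => //; apply: YX.
exists (set_type A), (@set_val H A); split.
  move=> i j; rewrite (PA _ _ (set_valP i) (set_valP j)).
  by rewrite (inj_eq val_inj).
move=> x xA; apply: contrapT => /eqP x0.
have nx : nrm x != 0 by apply: contra_neq x0; apply: nrm_eq0.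
pose y := ((nrm x)^-1)%:C *: x.
have yy : inner y y = 1.
  rewrite innerxx nrmZ cabs_real ger0_norm ?invr_ge0 ?nrm_ge0// mulVf//.
  by rewrite expr1n.
have yA z : A z -> inner z y = 0.
  by move=> Az; have := xA (SigSub (mem_set Az)); rewrite innerZr => ->; rewrite mulr0.
have yNA : ~ A y.
  by move=> /yA; rewrite yy => /eqP; rewrite oner_eq0.
apply: (Amax (A `|` [set y])).
  split; first by move=> z; left.
  by move=> /(_ y) h; apply/yNA/h; right.
move=> u v [Au|->] [Av|->].
- exact: PA.
- by rewrite yA//; case: eqP => // uy; case: yNA; rewrite -uy.
- by rewrite innerC yA// rmorph0; case: eqP => // vy; case: yNA; rewrite vy.
- by rewrite yy eqxx.
Qed.

Section Basis.
Variables (I : choiceType) (e : I -> H).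
Hypothesis eB : orthonormal_basis e.

Definition fourier_sum x s : H := \sum_(i <- s) inner (e i) x *: e i.

Lemma inner_fourier_sum x s i : uniq s -> i \in s ->
  inner (e i) (fourier_sum x s) = inner (e i) x.
Proof.
move=> us si; rewrite inner_sumr (bigD1_seq i)//= innerZr (proj1 eB) eqxx mulr1.
rewrite big1 ?addr0// => j ji; rewrite innerZr (proj1 eB) eq_sym (negPf ji) mulr0 //.
Qed.

Lemma nrm_fourier_rest x s : uniq s ->
  nrm (x - fourier_sum x s) ^+ 2 = nrm x ^+ 2 - \sum_(i <- s) cabs (inner (e i) x) ^+ 2.
Proof.
move=> us.
have sq (y : H) : inner (fourier_sum x s) y = \sum_(i <- s) cj (inner (e i) x) * inner (e i) y.
  by rewrite inner_suml; apply: eq_bigr => i _; rewrite innerZl.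
have e1 : inner (fourier_sum x s) x = (\sum_(i <- s) cabs (inner (e i) x) ^+ 2)%:C.
  by rewrite sq rmorph_sum/=; apply: eq_bigr => i _; rewrite mul_conj.
have e2 : nrm (fourier_sum x s) ^+ 2 = \sum_(i <- s) cabs (inner (e i) x) ^+ 2.
  apply: complexI; rewrite -innerxx sq -e1 sq big_seq [RHS]big_seq.
  by apply: eq_bigr => i si; rewrite inner_fourier_sum.
by rewrite nrm_sqrB e2 Re_innerC e1 /=; ring.
Qed.

Definition span : set H :=
  [set x | exists w : seq (I * R[i]), x = \sum_(p <- w) p.2 *: e p.1].

Lemma span_subspace : is_subspace span.
Proof.
split; first by exists [::]; rewrite big_nil.
move=> k _ _ [v ->] [w ->]; exists (map (fun p => (p.1, k * p.2)) v ++ w).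
rewrite big_cat big_map/= scaler_sumr; congr (_ + _).
by apply: eq_bigr => p _; rewrite scalerA.
Qed.

Lemma span_dense x (d : R) : 0 < d -> exists2 z, span z & nrm (x - z) < d.
Proof.
move=> d0; have [p [pS pO]] := projection x span_subspace.
suff -> : x = p by apply: pS.
apply/eqP; rewrite -subr_eq0; apply/eqP/(proj2 eB) => i; apply: pO.
by exists [:: (i, 1)]; rewrite big_seq1 scale1r.
Qed.

(** The rest of the Fourier sum is orthogonal to all e_i involved, so Pythagoras applies. [w] may
    repeat an index, hence the [undup]. *)
Lemma fourier_best x w :
  nrm (x - fourier_sum x (undup (map fst w))) <= nrm (x - \sum_(p <- w) p.2 *: e p.1).
Proof.
set s := undup _; set z := \sum_(p <- w) _; have us : uniq s := undup_uniq _.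
have r0 i : i \in s -> inner (e i) (x - fourier_sum x s) = 0.
  by move=> si; rewrite innerBr inner_fourier_sum// subrr.
apply: ler_of_sqr; first exact: nrm_ge0.
have -> : x - z = (fourier_sum x s - z) + (x - fourier_sum x s).
  by rewrite [RHS]addrC addrA subrK.
rewrite [in leRHS]nrm_sqrD innerBl !inner_suml.
rewrite big_seq big1 => [|i si]; last by rewrite innerZl r0// mulr0.
rewrite big_seq big1 => [|q qw]; last first.
  by rewrite innerZl r0 ?mulr0// mem_undup map_f.
by rewrite subrr /= mulr0 addr0 lerDr sqr_ge0.
Qed.

Lemma parseval x : nsummable (fun i => cabs (inner (e i) x) ^+ 2) /\
  nsum (fun i => cabs (inner (e i) x) ^+ 2) = nrm x ^+ 2.
Proof.
have bd s : uniq s -> \sum_(i <- s) cabs (inner (e i) x) ^+ 2 <= nrm x ^+ 2.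
  by move=> us; rewrite -subr_ge0 -nrm_fourier_rest// sqr_ge0.
have sm : nsummable (fun i => cabs (inner (e i) x) ^+ 2) by exists (nrm x ^+ 2).
split => //; apply/eqP; rewrite eq_le nsum_le//=.
apply/ler_addgt0Pr => d d0.
have sd : 0 < Num.sqrt d by rewrite sqrtr_gt0.
have [_ [w ->] xw] := span_dense x sd.
have us : uniq (undup (map fst w)) := undup_uniq _.
have := le_lt_trans (fourier_best x w) xw.
rewrite -(@ltr_pXn2r _ 2)// ?nnegrE ?nrm_ge0 ?sqrtr_ge0// sqr_sqrtr ?(ltW d0)//.
rewrite nrm_fourier_rest// ltrBlDl => h; apply: le_trans (ltW h) _.
by rewrite lerD2r nsum_ub.
Qed.

Lemma parseval_inner x y :
  csum (fun i => inner x (e i) * inner (e i) y) (inner x y).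
Proof.
have ps : polar_sums (V := scalar_hilbert R) (fun i => inner (e i) x)
    (fun i => inner (e i) y) (fun l => nrm (x + l *: y) ^+ 2).
  move=> l _; have [h1 h2] := parseval (x + l *: y).
  have E : (fun i => nrm ((inner (e i) x : scalar_hilbert R) +
                          l *: (inner (e i) y : scalar_hilbert R)) ^+ 2)
      = (fun i => cabs (inner (e i) (x + l *: y)) ^+ 2).
    by apply/funext => i; rewrite innerDr innerZr.
  by split; rewrite E.
apply: csum_ext (polar_csum ps) _ _ => [i|].
  by rewrite [LHS]/inner/= /scalar_dot mulrC (innerC x) //.
have four0 : 4%:R != 0 :> R[i] by rewrite pnatr_eq0.
apply: (mulfI four0); rewrite mulVKf// polarization -!innerxx.
by rewrite scale1r scaleN1r scaleNr.
Qed.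

End Basis.

(* sum_i |a e_i|^2 = sum_{i,j} |<f_j, a e_i>|^2 = sum_j |b f_j|^2 *)
Lemma hilbert_schmidt_swap (I J : choiceType) (e : I -> H) (f : J -> H) (a b : H -> H) :
  orthonormal_basis e -> orthonormal_basis f -> is_adjoint a b ->
  nsummable (fun i => nrm (a (e i)) ^+ 2) ->
  nsummable (fun j => nrm (b (f j)) ^+ 2) /\
  nsum (fun j => nrm (b (f j)) ^+ 2) = nsum (fun i => nrm (a (e i)) ^+ 2).
Proof.
move=> eB fB ab.
pose F i j := cabs (inner (f j) (a (e i))) ^+ 2.
have F0 i j : 0 <= F i j by rewrite sqr_ge0.
have Fi i : nsummable (F i) by case: (parseval fB (a (e i))).
have E1 : (fun i => nrm (a (e i)) ^+ 2) = (fun i => nsum (F i)).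
  by apply/funext => i; case: (parseval fB (a (e i))).
have Fj j : F ^~ j = (fun i => cabs (inner (e i) (b (f j))) ^+ 2).
  by apply/funext => i; rewrite /F ab innerC cabs_conj.
have E2 : (fun j => nrm (b (f j)) ^+ 2) = (fun j => nsum (F ^~ j)).
  by apply/funext => j; rewrite Fj; case: (parseval eB (b (f j))).
by rewrite E1 E2 => h; have [_ h1 h2] := nsum_swap F0 Fi h.
Qed.

End OrthonormalBases.

(** * Square roots of positive operators and traces against density operators *)

Section Traces.
Variables (R : realType) (H : hilbertType R).
Implicit Types (x y z : H) (a b rho sigma s T : H -> H).

Lemma positive_self_adjoint a : bounded_operators a -> positive_operator a ->
  is_adjoint a a.
Proof.
move=> ab apos; have [b ab'] := adjoint_exists ab.
have bb := adjoint_bounded ab ab'.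
suff E : a = b by move: ab'; rewrite -E.
apply/funext => x; apply/eqP; rewrite -subr_eq0; apply/eqP.
apply: (@quadratic_form_eq0 _ _ (fun x => a x - b x)) => [k y z|y].
  by rewrite ab.1 bb.1 scalerBr opprD addrACA.
rewrite innerBr (adjoint_sym ab') (innerC (a y)).
have /ger0_real/complex_realP[r ->] := apos y.
by rewrite conjc_real subrr.
Qed.

(** After scaling to A = a / (C + 1), the iteration is run on T = 1 - A, whose bound 1 comes from |A
    x|^2 <= <x, A x>. *)
Lemma positive_sqrt a : bounded_operators a -> positive_operator a ->
  exists s, [/\ bounded_operators s, is_adjoint s s & s \o s = a].
Proof.
move=> ab apos; have aa := positive_self_adjoint ab apos.
have [C C0 aC] := bounded_norm ab.
have C1 : 0 < C + 1 by rewrite ltr_wpDl.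
pose k : R[i] := ((C + 1)^-1)%:C.
have al := ab.1.
have A1 x : nrm (k *: a x) <= nrm x.
  rewrite nrmZ cabs_real ger0_norm ?invr_ge0 ?(ltW C1)// ler_pdivrMl//.
  by apply: le_trans (aC _) _; rewrite ler_wpM2r ?nrm_ge0// lerDl.
have Apos x : 0 <= Re (inner x (k *: a x)).
  rewrite innerZr Re_mulr mulr_ge0 ?invr_ge0 ?(ltW C1)//.
  by have := apos x; rewrite lecE => /andP[].
have Asa x y : inner x (k *: a y) = inner (k *: a x) y.
  by rewrite innerZr innerZl conjc_real aa.
(* Positivity of A at x - A x gives <x, A x> - 2 |A x|^2 + <A x, A A x> >= 0, and the last term is
   at most |A x|^2. *)
have Asq x : nrm (k *: a x) ^+ 2 <= Re (inner x (k *: a x)).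
  have := Apos (x - k *: a x).
  set y := k *: a x; rewrite (linB _ _ al) scalerBr -/y innerBl !innerBr.
  rewrite (Asa x y) -/y !innerxx !ReD !ReN !ReD !ReN /= => h.
  have : Re (inner y (k *: a y)) <= nrm y ^+ 2.
    apply: le_trans (Re_le_cabs _) _; apply: le_trans (cauchy_schwarz _ _) _.
    by rewrite expr2 ler_wpM2l ?nrm_ge0 ?A1.
  by move: h; rewrite ?ReN ?ReD; lra.
pose T x := x - k *: a x.
have [|||s [sl sq st _ ss]] := @sqrt_operator _ _ T 1.
- move=> l x y; rewrite /T al scalerDr !scalerA [k * l]mulrC -scalerA.
  by rewrite scalerBr opprD addrACA.
- move=> x; rewrite mul1r; apply: ler_of_sqr; first exact: nrm_ge0.
  rewrite nrm_sqrB.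
  by have := Asq x; have := Apos x; lra.
- by rewrite ler01 lexx.
pose m : R[i] := (Num.sqrt (C + 1))%:C.
have sb : bounded_operators s.
  apply: (@boundedI _ _ _ 2) => // x.
  rewrite -[s x]opprK -[- s x](addKr x) nrmN mulr_natl mulr2n.
  by apply: le_trans (nrmD _ _) _; rewrite nrmN lerD// -[leRHS]mul1r.
exists (m \*: s); split.
- exact: bounded_scale.
- have := adjointZ m (ss _); rewrite conjc_real; apply.
  by move=> x y; rewrite /T innerBr innerBl Asa.
- apply/funext => x /=; rewrite (linZ _ _ sl) scalerA sq /T opprB addrCA subrr addr0.
  rewrite scalerA -!rmorphM/= -expr2 sqr_sqrtr ?(ltW C1)// mulfV ?scale1r//.
  by rewrite gt_eqF.
Qed.

(** Uniqueness of the trace rests on the existence of at least one orthonormal basis, as [has_trace]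
    quantifies over all of them. *)
Lemma has_trace_tr T t : has_trace T t -> tr T = t.
Proof.
move=> Tt; have [I [e eB]] := onb_exists H.
have /xgetPex : exists t, has_trace T t by exists t.
move=> /(_ 0 I e eB) h; apply: csum_unique (has_sum_csum h) (has_sum_csum (Tt _ _ eB)).
Qed.

Lemma cabs_phase (l : R[i]) : l \in unit_phases R -> cabs l = 1.
Proof.
by rewrite !inE => /or4P[] /eqP ->; rewrite ?cabsN ?cabsi//;
  rewrite -[1]/(1%:C) cabs_real normr1.
Qed.

Section Density.
Variables (rho s : H -> H).
Hypothesis rhoD : density_operator rho.
Hypothesis sb : bounded_operators s.
Hypothesis ss : is_adjoint s s.
Hypothesis srho : s \o s = rho.

Lemma density_summable (J : choiceType) (f : J -> H) : orthonormal_basis f ->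
  nsummable (fun j => nrm (s (f j)) ^+ 2).
Proof.
move=> fB; have [_ _ /(_ _ _ fB)/has_sum_csum h] := rhoD.
suff h' : csum (fun j => (nrm (s (f j)) ^+ 2)%:C) 1.
  by have [] := csum_nonneg (fun j => sqr_ge0 _) h'.
by apply: csum_ext h _ _ => // j; rewrite -srho /= ss innerxx.
Qed.

(** The cyclicity tr (s s a) = tr (s a s). It also shows that [rho \o a] has a trace, so that [tr]
    is not at its default value. *)
Lemma density_trace (J : choiceType) (f : J -> H) a : orthonormal_basis f ->
  bounded_operators a ->
  csum (fun j => inner (s (f j)) (a (s (f j)))) (tr (rho \o a)).
Proof.
move=> fB ab; have [b ab'] := adjoint_exists ab.
have bb := adjoint_bounded ab ab'; have [C C0 bC] := bounded_norm bb.
(* The squared Hilbert-Schmidt norm of (1 + cj l b) s. Its adjoint s (1 + l a) has the same one in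
   every basis, so q serves both sides of the polarization. *)
pose q l := nsum (fun j => nrm (s (f j) + cj l *: b (s (f j))) ^+ 2).
have qs l : l \in unit_phases R ->
    nsummable (fun j => nrm (s (f j) + cj l *: b (s (f j))) ^+ 2).
  move=> lP; apply: nsummable_le (nsummableZ (sqr_ge0 (1 + C)) (density_summable fB)) => j.
  rewrite -exprMn ler_pXn2r// ?nnegrE ?nrm_ge0//; last first.
    by rewrite mulr_ge0 ?nrm_ge0// addr_ge0.
  apply: le_trans (nrmD _ _) _; rewrite nrmZ cabs_conj cabs_phase// mul1r.
  by rewrite mulrDl mul1r lerD.
have pf : polar_sums (fun j => b (s (f j))) (fun j => s (f j)) q.
  move=> l lP.
  suff -> : (fun j => nrm (b (s (f j)) + l *: s (f j)) ^+ 2) =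
    (fun j => nrm (s (f j) + cj l *: b (s (f j))) ^+ 2) by split => //; apply: qs.
  apply/funext => j; rewrite -[b _ + _](_ : l *: (s (f j) + cj l *: b (s (f j))) = _).
    by rewrite nrmZ cabs_phase// mul1r.
  by rewrite scalerDr scalerA mulrC mul_conj cabs_phase// expr1n scale1r addrC.
have pe (I : choiceType) (e : I -> H) : orthonormal_basis e ->
    polar_sums (fun i => s (e i)) (fun i => s (a (e i))) q.
  move=> eB l lP.
  have adj : is_adjoint (fun x => s x + cj l *: b (s x)) (fun x => s (x + l *: a x)).
    move=> x y; rewrite innerDr innerZr -ss innerDl innerZl (adjoint_sym ab') !ss.
    by rewrite -!ss //.
  have [h1 h2] := hilbert_schmidt_swap fB eB adj (qs l lP).
  suff E : (fun i => nrm (s (e i) + l *: s (a (e i))) ^+ 2) =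
    (fun i => nrm (s (e i + l *: a (e i))) ^+ 2) by rewrite E.
  by apply/funext => i; rewrite (linD sb.1) (linZ _ _ sb.1).
have tq : has_trace (rho \o a) (polar_value q).
  move=> I e eB; apply/csum_has_sum.
  by apply: csum_ext (polar_csum (pe _ _ eB)) _ _ => // i; rewrite /= -srho /= [RHS]ss.
rewrite (has_trace_tr tq).
by apply: csum_ext (polar_csum pf) _ _ => // j; rewrite ab'.
Qed.

End Density.
End Traces.

(** * Local tomography *)

Section OrthogonalComplement.
Variables (R : realType) (K : hilbertType R) (S : set K).

Definition orth_compl : set K := [set x | forall z, S z -> inner x z = 0].

Lemma orth_compl_subspace : is_subspace orth_compl.
Proof.
split; first by move=> z _; rewrite inner0l.
by move=> k x y xN yN z Sz; rewrite innerDl innerZl xN// yN// mulr0 addr0.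
Qed.

Lemma orth_compl_projection : exists Q : K -> K,
  (forall x, orth_compl (Q x)) /\
  (forall x y, orth_compl y -> inner y (x - Q x) = 0).
Proof.
suff /choice[Q QP] x : exists p, orth_compl p /\
    forall y, orth_compl y -> inner y (x - p) = 0.
  by exists Q; split=> [x|x y]; case: (QP x) => // _; apply.
have [p [pN pO]] := projection x orth_compl_subspace; exists p; split => // z Sz.
apply: cabs_eq0; apply: le_all_eq0 (cabs_ge0 _) _ => e e0.
have z1 : 0 < nrm z + 1 by rewrite ltr_wpDl ?nrm_ge0.
have [y yN py] := pN _ (divr_gt0 e0 z1).
rewrite -[inner p z]subr0 -(yN z Sz) -innerBl; apply: le_trans (cauchy_schwarz _ _) _.
move: py; rewrite ltr_pdivlMr// => /ltW; apply: le_trans.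
by rewrite ler_wpM2l ?nrm_ge0// lerDl.
Qed.

Variable Q : K -> K.
Hypothesis QN : forall x, orth_compl (Q x).
Hypothesis QO : forall x y, orth_compl y -> inner y (x - Q x) = 0.

Lemma projection_unique x p : orth_compl p ->
  (forall y, orth_compl y -> inner y (x - p) = 0) -> Q x = p.
Proof.
move=> pN pO; have N := orth_compl_subspace.
have dN : orth_compl (Q x - p).
  rewrite -scaleN1r; apply: (subspaceD N (QN x)); exact: (subspaceZ _ N pN).
have : inner (Q x - p) (Q x - p) = 0.
  have E : (x - p) - (x - Q x) = Q x - p by rewrite opprB addrC addrA subrK.
  by rewrite -{2}E innerBr pO// QO// subrr.
rewrite innerxx => /complexI/eqP; rewrite sqrf_eq0 => /eqP/nrm_eq0/eqP.
by rewrite subr_eq0 => /eqP.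
Qed.

Lemma projection_linear : linear Q.
Proof.
move=> k x y; apply: projection_unique.
  by have [_] := orth_compl_subspace; apply.
move=> z zN; rewrite opprD addrACA -scalerBr innerDr innerZr !QO// mulr0 addr0 //.
Qed.

Lemma projection_bounded : bounded_operators Q.
Proof.
apply: (@boundedI _ _ _ 1 projection_linear) => x; rewrite mul1r.
apply: ler_of_sqr; first exact: nrm_ge0.
rewrite -[x in leRHS](subrK (Q x)) addrC nrm_sqrD QO//= mulr0 addr0.
by rewrite lerDl sqr_ge0.
Qed.

Lemma projection_commutes c c' : linear c -> is_adjoint c c' ->
  (forall y, orth_compl y -> orth_compl (c y)) ->
  (forall y, orth_compl y -> orth_compl (c' y)) ->
  forall x, Q (c x) = c (Q x).
Proof.
move=> cl cc cN c'N x; apply: projection_unique; first exact/cN/QN.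
by move=> y yN; rewrite -(linB _ _ cl) cc QO//; apply: c'N.
Qed.

Lemma projection_fix0 x : S x -> Q x = 0.
Proof.
move=> Sx; apply: projection_unique; first by move=> z _; rewrite inner0l.
by move=> y yN; rewrite subr0 yN.
Qed.

Lemma projection_annihilates x y : orth_compl y -> Q x = 0 -> inner y x = 0.
Proof. by move=> yN Qx; rewrite -[x]subr0 -Qx QO. Qed.

End OrthogonalComplement.

(** * Operators acting diagonally on a direct sum of copies of H *)

Section Amplification.
Variables (R : realType) (L : choiceType) (H : hilbertType R).
Implicit Types (a b : H -> H).

Local Notation K := (l2_hilbert L H).

Lemma l2_innerE (f g : K) : csum (fun i => inner (l2val f i) (l2val g i)) (inner f g).
Proof. exact: l2_inner_csum. Qed.

Lemma csum_single (f : L -> R[i]) k : (forall i, i != k -> f i = 0) -> csum f (f k).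
Proof.
move=> fk e e0; exists [:: k] => s us ks.
rewrite (bigD1_seq k)//=; last by apply: ks; rewrite inE.
by rewrite big1 ?addr0 ?subrr ?cabs0// => i /fk.
Qed.

Lemma l2_inner_eq (f f' g g' : K) :
  (forall i, inner (l2val f i) (l2val g i) = inner (l2val f' i) (l2val g' i)) ->
  inner f g = inner f' g'.
Proof.
move=> fg; apply: csum_unique (l2_innerE f g) _.
by apply: csum_ext (l2_innerE f' g') _ _.
Qed.

Lemma delta_mem k (v : H) : (fun i => if i == k then v else 0) \in @l2_pred R L H.
Proof.
apply/asboolP; exists (nrm v ^+ 2) => s us.
have [ks|ks] := boolP (k \in s).
  rewrite (bigD1_seq k)//= eqxx big1 ?addr0// => i /negPf ->.
  by rewrite nrm0 expr0n.
rewrite big_seq big1 ?sqr_ge0// => i si.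
by case: eqP => [ik|_]; [rewrite -ik si in ks | rewrite nrm0 expr0n].
Qed.

Definition delta k (v : H) : K := L2 (delta_mem k v).

Lemma inner_delta k v (f : K) : inner (delta k v) f = inner v (l2val f k).
Proof.
apply: csum_unique (l2_innerE _ _) _.
have := @csum_single (fun i => inner (l2val (delta k v) i) (l2val f i)) k.
rewrite /= eqxx; apply => i /negPf ->.
by rewrite inner0l.
Qed.

Lemma delta_linear k : forall (l : R[i]) u v, delta k (l *: u + v) = l *: delta k u + delta k v.
Proof.
move=> l u v; apply: l2_eq => i; rewrite l2D l2Z /=; case: eqP => // _.
by rewrite scaler0 addr0.
Qed.

Lemma nrm_delta k v : nrm (delta k v) = nrm v.
Proof.
apply/eqP; rewrite -(@eqrXn2 _ 2) ?nrm_ge0//; apply/eqP/complexI.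
by rewrite -innerxx inner_delta /= eqxx innerxx.
Qed.

Lemma nrm_coord (f : K) i : nrm (l2val f i) <= nrm f.
Proof. exact: nrm_le_l2n. Qed.

(** The adjoint stands in for density of finitely supported vectors: each coordinate of [T' g] is
    orthogonal to all of H. *)
Lemma bounded_delta_eq0 (T : K -> K) : bounded_operators T ->
  (forall k v, T (delta k v) = 0) -> forall f, T f = 0.
Proof.
move=> Tb Td f; have [T' TT'] := adjoint_exists Tb.
apply: inner_eq0 => g; rewrite TT'.
suff -> : T' g = 0 by rewrite inner0l.
apply: l2_eq => i; apply: inner_eq0 => v.
by rewrite -inner_delta (adjoint_sym TT') Td inner0l.
Qed.

Lemma amp_mem a : bounded_operators a -> forall f : K,
  (fun i => a (l2val f i)) \in @l2_pred R L H.
Proof.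
move=> /bounded_norm[C C0 aC] f; apply/asboolP.
apply: nsummable_le (nsummableZ (sqr_ge0 C) (l2_summable f)) => i.
by rewrite -exprMn ler_pXn2r// ?nnegrE ?mulr_ge0 ?nrm_ge0.
Qed.

Definition amp a (ab : bounded_operators a) (f : K) : K := L2 (amp_mem ab f).

Lemma amp_linear a (ab : bounded_operators a) : linear (amp ab).
Proof. by move=> k f g; apply: l2_eq => i; rewrite l2D l2Z /= ab.1. Qed.

Lemma amp_adjoint a b (ab : bounded_operators a) (bb : bounded_operators b) :
  is_adjoint a b -> is_adjoint (amp ab) (amp bb).
Proof. by move=> adj f g; apply: l2_inner_eq => i /=. Qed.

Lemma amp_bounded a (ab : bounded_operators a) : bounded_operators (amp ab).
Proof.
have [C C0 aC] := bounded_norm ab.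
apply: (@boundedI _ _ _ C); first exact: amp_linear.
move=> f; apply: l2n_le => [|s us]; first by rewrite mulr_ge0 ?nrm_ge0.
rewrite exprMn; apply: le_trans (_ : _ <= C ^+ 2 * \sum_(i <- s) nrm (l2val f i) ^+ 2) _.
  rewrite mulr_sumr; apply: ler_sum => i _; rewrite -exprMn.
  rewrite ler_pXn2r// ?nnegrE ?mulr_ge0 ?nrm_ge0//; exact: aC.
by rewrite ler_wpM2l ?sqr_ge0//; apply: l2n_ub.
Qed.

Lemma amp_delta a (ab : bounded_operators a) k v : amp ab (delta k v) = delta k (a v).
Proof.
by apply: l2_eq => i /=; case: eqP => // _; rewrite (lin0 ab.1).
Qed.

(* The matrix entries of Q are operators on H commuting with S, hence scalars. *)
Lemma amplification_commutes (S : set (H -> H)) (Q : K -> K)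
    (Sb : S `<=` bounded_operators (H:=H)) : commutant S `<=` scalar_operators (H:=H) ->
  bounded_operators Q ->
  (forall a (Sa : S a) f, Q (amp (Sb _ Sa) f) = amp (Sb _ Sa) (Q f)) ->
  forall x (xb : bounded_operators x) f, Q (amp xb f) = amp xb (Q f).
Proof.
move=> Sscal Qb QS x xb f; have Ql := Qb.1.
pose entry k l v := l2val (Q (delta k v)) l.
have scal k l : exists c : R[i], forall v, entry k l v = c *: v.
  have [C C0 QC] := bounded_norm Qb.
  have : commutant S (entry k l).
    apply: commutantI.
      apply: (@boundedI _ _ _ C) => [z u v|v].
        by rewrite /entry delta_linear Ql l2D l2Z.
      by apply: le_trans (nrm_coord _ _) _; rewrite -(nrm_delta k v).
    by move=> a v Sa; rewrite /entry -(amp_delta (Sb _ Sa)) QS.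
  by move=> /Sscal[c ->]; exists c.
have /(_ f) : forall f, (Q \o amp xb \+ (-1) \*: (amp xb \o Q)) f = 0.
  apply: bounded_delta_eq0 => [|k v].
    apply: bounded_add; first exact: bounded_comp Qb (amp_bounded xb).
    by apply: bounded_scale; apply: bounded_comp (amp_bounded xb) Qb.
  apply: l2_eq => l; rewrite l2D l2Z /= amp_delta.
  have [c cP] := scal k l.
  rewrite -/(entry k l (x v)) -/(entry k l v) !cP (linZ _ _ xb.1).
  by rewrite scaleN1r subrr.
by rewrite /= scaleN1r => /eqP; rewrite subr_eq0 => /eqP.
Qed.

End Amplification.

Section Tomography.
Variables (R : realType) (H : hilbertType R).
Implicit Types (x y z : H) (a b c rho sigma s t : H -> H) (MA MB : set (H -> H)).

Definition sum_family (J : choiceType) (f g : J -> H) (i : J + J) : H :=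
  match i with inl j => f j | inr j => g j end.

Lemma sum_family_mem (J : choiceType) (f g : J -> H) :
  nsummable (fun j => nrm (f j) ^+ 2) -> nsummable (fun j => nrm (g j) ^+ 2) ->
  sum_family f g \in @l2_pred R (J + J)%type H.
Proof.
move=> fs gs; apply/asboolP.
have := csum_sumtype (f := fun i => (nrm (sum_family f g i) ^+ 2)%:C)
  (csum_nsum (fun j => sqr_ge0 (nrm (f j))) fs)
  (csum_nsum (fun j => sqr_ge0 (nrm (g j))) gs).
by move=> /(csum_nonneg (fun i => sqr_ge0 (nrm (sum_family f g i))))[].
Qed.

(* The vectors (s f_j) + (t f_j) and (s f_j) + (- t f_j) of l2 (J + J, H), where
   s^2 = rho and t^2 = sigma, represent x |-> tr (rho x) - tr (sigma x) as a
   matrix coefficient of the amplification of x. *)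
Lemma irreducible_local_tomography MA MB :
  star_subalgebra MA -> star_subalgebra MB -> commuting_operators MA MB ->
  commutant (MA `|` MB) `<=` scalar_operators (H:=H) -> local_tomography MA MB.
Proof.
move=> sA sB AB irr rho sigma rhoD sigmaD corr.
have [rb rpos _] := rhoD; have [gb gpos _] := sigmaD.
have [s [sb ss srho]] := positive_sqrt rb rpos.
have [t [tb tt tsigma]] := positive_sqrt gb gpos.
have [J [f fB]] := onb_exists H.
have s2 := density_summable rhoD ss srho fB.
have t2 := density_summable sigmaD tt tsigma fB.
have t2' : nsummable (fun j => nrm (- t (f j)) ^+ 2).
  by under [X in nsummable X]funext do rewrite nrmN.
pose K := l2_hilbert (J + J)%type H.
pose Om : K := L2 (sum_family_mem s2 t2).
pose Om' : K := L2 (sum_family_mem s2 t2').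
pose S := MA `|` MB.
have Sb : S `<=` bounded_operators (H:=H).
  by move=> a [/(star_sub sA)|/(star_sub sB)].
(* [X] is not a linear subspace; only its orthogonal complement is used, and that is the complement
   of its span. *)
pose X := [set z : K | exists a b, [/\ MA a, MB b &
  forall i, l2val z i = a (b (l2val Om i))]].
have ABE a b y : MA a -> MB b -> a (b y) = b (a y).
  by move=> Aa Bb; exact: (congr1 (fun f => f y) (AB _ _ Aa Bb)).
have [Q [QN QO]] := orth_compl_projection X.
have Sadj c : S c -> exists2 c', S c' & is_adjoint c c'.
  move=> [Ac|Bc].
    by have [c' ? ?] := star_adj sA Ac; exists c' => //; left.
  by have [c' ? ?] := star_adj sB Bc; exists c' => //; right.
have XS c (Sc : S c) (z : K) : X z -> X (amp (Sb _ Sc) z).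
  move=> [a [b [Aa Bb zE]]]; case: (Sc) => [Ac|Bc].
    exists (c \o a), b; split => // [|i]; first exact: (star_mul sA Ac Aa).
    exact: (congr1 c (zE i)).
  exists a, (c \o b); split => // [|i]; first exact: (star_mul sB Bc Bb).
  by rewrite [LHS]/= zE [RHS]/= (ABE a c _ Aa Bc).
have NS c (Sc : S c) (y : K) : orth_compl X y -> orth_compl X (amp (Sb _ Sc) y).
  move=> yN z Xz; have [c' Sc' cc'] := Sadj _ Sc.
  rewrite -(amp_adjoint (Sb _ Sc') (Sb _ Sc) (adjoint_sym cc')).
  exact/yN/XS.
have QS c (Sc : S c) (g : K) : Q (amp (Sb _ Sc) g) = amp (Sb _ Sc) (Q g).
  have [c' Sc' cc'] := Sadj _ Sc.
  apply: (projection_commutes QN QO _ (amp_adjoint (Sb _ Sc) (Sb _ Sc') cc')).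
  - exact: amp_linear.
  - exact: NS.
  - exact: NS.
have Qall := amplification_commutes irr (projection_bounded QN QO) QS.
have QOm : Q Om = 0.
  apply: (projection_fix0 QN QO); exists id, id.
  by split => //; [exact: (star_unit sA) | exact: (star_unit sB)].
have coef (x : H -> H) : bounded_operators x ->
    csum (fun i => inner (l2val Om' i) (x (l2val Om i)))
      (tr (rho \o x) - tr (sigma \o x)).
  move=> xb; apply: csum_sumtype; first exact: (density_trace rhoD sb ss srho fB xb).
  have := csumZ (-1) (density_trace sigmaD tb tt tsigma fB xb); rewrite mulN1r.
  by move=> h; apply: csum_ext h _ _ => // j /=; rewrite mulN1r innerNl.
(* This is where the equality of the correlation functions enters. *)
have Om'N : orth_compl X Om'.
  move=> z [a [b [Aa Bb zE]]].
  have abb : bounded_operators (a \o b).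
    exact: bounded_comp (star_sub sA Aa) (star_sub sB Bb).
  have := coef _ abb; rewrite (_ : tr _ - tr _ = 0); last first.
    have E : tr (rho \o (a \o b)) = tr (sigma \o (a \o b)) := corr a b Aa Bb.
    by rewrite E subrr.
  move=> h; apply: csum_unique (l2_innerE _ _) _.
  by apply: csum_ext h _ _ => // i; rewrite zE.
have vanish (x : H -> H) (xb : bounded_operators x) : inner Om' (amp xb Om) = 0.
  apply: (projection_annihilates QO Om'N); rewrite Qall QOm.
  exact: lin0 (amp_linear xb).
apply/funext => u; apply: inner_inj => v.
(* For this rank one operator the matrix coefficient is <v, rho u> - <v, sigma u>. *)
pose x (y : H) := inner v y *: u.
have xb : bounded_operators x.
  apply: (@boundedI _ _ _ (nrm v * nrm u)) => [k y z|y].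
    by rewrite /x innerDr innerZr scalerDl scalerA.
  by rewrite nrmZ mulrAC ler_wpM2r ?nrm_ge0// cauchy_schwarz.
have rank1 (r : H -> H) (r_adj : is_adjoint r r) :
    csum (fun j => inner (r (f j)) (x (r (f j)))) (inner v (r (r u))).
  rewrite r_adj.
  apply: csum_ext (parseval_inner fB (r v) (r u)) _ _ => // j.
  by rewrite /x innerZr r_adj (adjoint_sym r_adj) //.
have : csum (fun i => inner (l2val Om' i) (x (l2val Om i)))
    (inner v (s (s u)) - inner v (t (t u))).
  apply: csum_sumtype; first exact: rank1.
  have := csumZ (-1) (rank1 t tt); rewrite mulN1r.
  by move=> h; apply: csum_ext h _ _ => // j /=; rewrite mulN1r innerNl.
have h0 : csum (fun i => inner (l2val Om' i) (x (l2val Om i))) 0.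
  by have := l2_innerE Om' (amp xb Om); rewrite vanish.
move=> /(csum_unique h0)/esym/eqP; rewrite subr_eq0 => /eqP.
by rewrite -[s (s u)]/((s \o s) u) -[t (t u)]/((t \o t) u) srho tsigma.
Qed.

(** Under Haag duality M_B' = M_A'' = M_A, so an operator commuting with both algebras lies in the
    centre of M_A. *)
Lemma haag_local_tomography MA MB : vn_factor MA -> vn_factor MB ->
  commuting_operators MA MB -> haag_duality MA MB -> local_tomography MA MB.
Proof.
move=> [[sA MA2] FA] [[sB _] _] AB hd.
apply: irreducible_local_tomography => // a aS; rewrite -FA.
have aA : commutant MA a by apply: commutant_anti aS; apply: subsetUl.
split => //; rewrite MA2 -hd; apply: commutant_anti aS; exact: subsetUr.
Qed.

End Tomography.

(** * Factors of a group and the counterexample *)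

Section Reindexing.
Variables (R : realType) (I : choiceType) (V : hilbertType R).

Local Notation K := (l2_hilbert I V).

Lemma csum_reindex (f : I -> R[i]) z (s t : I -> I) : cancel s t -> cancel t s ->
  csum f z -> csum (f \o s) z.
Proof.
move=> st ts fz e /fz[u uP]; exists (map t u) => w uw tw.
rewrite -(big_map s xpredT f); apply: uP.
  by rewrite map_inj_uniq//; apply: can_inj st.
by move=> k ku; rewrite -(ts k) map_f// tw// map_f.
Qed.

Lemma reindex_mem (s : I -> I) : injective s -> forall f : K,
  (fun i => l2val f (s i)) \in @l2_pred R I V.
Proof.
move=> sI f; apply/asboolP; have [M fM] := l2_summable f; exists M => u uu.
rewrite -(big_map s xpredT (fun i => nrm (l2val f i) ^+ 2)).
by apply: fM; rewrite map_inj_uniq.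
Qed.

Definition reindex (s : I -> I) (sI : injective s) (f : K) : K := L2 (reindex_mem sI f).

Lemma reindex_bounded (s : I -> I) (sI : injective s) :
  bounded_operators (reindex sI).
Proof.
apply: (@boundedI _ _ _ 1) => [k f g|f]; first by apply: l2_eq => i; rewrite l2D l2Z.
rewrite mul1r; apply: l2n_le => [|u uu]; first exact: nrm_ge0.
rewrite -(big_map s xpredT (fun i => nrm (l2val f i) ^+ 2)).
by apply: l2n_ub; rewrite map_inj_uniq.
Qed.

Lemma reindex_adjoint (s t : I -> I) (sI : injective s) (tI : injective t) :
  cancel s t -> cancel t s -> is_adjoint (reindex sI) (reindex tI).
Proof.
move=> st ts f g; apply: csum_unique (l2_innerE _ _) _.
apply: csum_ext (csum_reindex st ts (l2_innerE (reindex tI f) g)) _ _ => // i.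
by rewrite /= st.
Qed.

Lemma restrict_mem (D : set I) (f : K) :
  (fun i => if `[< D i >] then l2val f i else 0) \in @l2_pred R I V.
Proof.
apply/asboolP; apply: nsummable_le (l2_summable f) => i.
by case: ifP => // _; rewrite nrm0 expr0n sqr_ge0.
Qed.

Definition restrict (D : set I) (f : K) : K := L2 (restrict_mem D f).

Lemma restrict_bounded (D : set I) : bounded_operators (restrict D).
Proof.
apply: (@boundedI _ _ _ 1) => [k f g|f].
  by apply: l2_eq => i; rewrite l2D l2Z /=; case: ifP => // _; rewrite scaler0 addr0.
rewrite mul1r; apply: l2n_le => [|u uu]; first exact: nrm_ge0.
apply: le_trans (l2n_ub f uu); apply: ler_sum => i _ /=.
by case: ifP => // _; rewrite nrm0 expr0n sqr_ge0.
Qed.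

(** A square summable family cannot take one nonzero value infinitely often: n times its squared
    norm would stay below |f|^2. *)
Lemma l2_infinite_level (f : K) i (u : nat -> I) : injective u ->
  (forall n, l2val f (u n) = l2val f i) -> l2val f i = 0.
Proof.
move=> uI fu; apply: nrm_eq0; apply/eqP; rewrite -sqrf_eq0.
set r := nrm _ ^+ 2; apply/negPn/negP => r0.
have rp : 0 < r by rewrite lt_def r0 sqr_ge0.
have bd n : n%:R * r <= nrm f ^+ 2.
  have un : uniq (map u (iota 0 n)) by rewrite map_inj_uniq ?iota_uniq.
  apply: le_trans (l2n_ub f un); rewrite big_map.
  under eq_bigr do rewrite fu.
  by rewrite big_const_seq count_predT size_iota iter_addr_0 mulr_natl.
have := bd (Num.bound (nrm f ^+ 2 / r)).
rewrite -ler_pdivlMr// leNgt => /negP; apply.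
by apply: archi_boundP; rewrite divr_ge0 ?sqr_ge0 ?ltW.
Qed.

End Reindexing.

Section GroupFactors.
Variables (R : realType) (G : groupType).
Implicit Types (g h k : G) (D : set G).

Local Open Scope group_scope.

Local Notation V := (scalar_hilbert R).
Local Notation K := (l2_hilbert G V).

Definition left_shift g : K -> K := reindex (mulgI g^-1).
Definition right_shift g : K -> K := reindex (mulIg g).

Definition left_shifts D : set (K -> K) := [set a | exists2 g, D g & a = left_shift g].

Lemma left_shift_adjoint g : is_adjoint (left_shift g) (left_shift g^-1).
Proof.
by apply: reindex_adjoint => h; rewrite ?invgK ?mulKg ?mulVKg.
Qed.

Lemma left_shift_delta g h v : left_shift g (delta h v) = delta (g * h) v.
Proof.
apply: l2_eq => k /=; congr (if _ then _ else _).
by apply/eqP/eqP => [<-|->]; rewrite ?mulVKg ?mulKg.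
Qed.

Lemma right_shift_delta g h v : right_shift g (delta h v) = delta (h * g^-1) v.
Proof.
apply: l2_eq => k /=; congr (if _ then _ else _).
by apply/eqP/eqP => [<-|->]; rewrite ?mulgK ?mulgVK.
Qed.

Lemma left_shifts_bounded D : left_shifts D `<=` bounded_operators (H:=K).
Proof. by move=> _ [g _ ->]; apply: reindex_bounded. Qed.

Lemma left_shifts_adjoint_closed D : (forall g, D g -> D g^-1) ->
  adjoint_closed (left_shifts D).
Proof.
move=> Dv _ [g Dg ->]; exists (left_shift g^-1); last exact: left_shift_adjoint.
by exists g^-1 => //; apply: Dv.
Qed.

Lemma right_shift_commutant D g : commutant (left_shifts D) (right_shift g).
Proof.
apply: commutantI; first exact: reindex_bounded.
by move=> _ f [h _ ->]; apply: l2_eq => k /=; rewrite mulgA.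
Qed.

(** [g] ranges over all of G while only [D] conjugates. This relative form yields the trivial
    relative commutant as well as the factor property for both [D] and G. *)
Definition infinite_conjugates D := forall g, g != 1 ->
  exists u : nat -> G, (forall n, D (u n)) /\ injective (fun n => (u n)^-1 * g * u n).

Lemma scalar_commutant (H : hilbertType R) (S : set (H -> H)) :
  S `<=` bounded_operators (H:=H) -> scalar_operators (H:=H) `<=` commutant S.
Proof.
move=> Sb _ [c ->]; apply: commutantI => [|b x Sb'].
  exact: bounded_scale (bounded_id H).
by rewrite /= (linZ _ _ (Sb _ Sb').1).
Qed.

(* T delta_1 is invariant under conjugation by D, and square summable, hence
   supported at 1. *)
Lemma shift_commutant_scalar D T : infinite_conjugates D ->
  commutant (left_shifts D) T -> (forall g f, T (right_shift g f) = right_shift g (T f)) ->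
  scalar_operators T.
Proof.
move=> Dinf TD TR; have Tl := TD.1.1.
pose one : V := (1%R : R[i]).
pose f := T (delta 1 one).
have finv g h : D h -> l2val f (h^-1 * g * h) = l2val f g.
  move=> Dh; have : f = left_shift h (right_shift h f).
    rewrite /f -TR -(commutantE _ TD); last by exists h.
    by rewrite right_shift_delta left_shift_delta mul1g mulgV.
  by move=> /(congr1 (fun f => l2val f g)) /= ->.
have f0 g : g != 1 -> l2val f g = 0.
  move=> /Dinf[u [uD uI]].
  by apply: (l2_infinite_level uI) => n; apply: finv.
pose c : R[i] := l2val f 1.
exists c; apply/funext => x; apply/eqP; rewrite -subr_eq0; apply/eqP.
have /(_ x) : forall x, (T \+ (- c)%R \*: id) x = 0%R.
  apply: bounded_delta_eq0 => [|g v].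
    by apply: bounded_add TD.1 (bounded_scale _ (bounded_id _)).
  have -> : delta g v = right_shift g^-1 ((v : R[i]) *: delta 1 one).
    rewrite -[RHS](_ : right_shift g^-1 (delta 1 v) = _).
      by rewrite right_shift_delta mul1g invgK.
    congr (right_shift _ _); apply: l2_eq => k; rewrite l2Z /=.
    by case: eqP => _; [rewrite /one; apply/esym/mulr1 | rewrite scaler0].
  rewrite /= TR (linZ _ _ Tl) -/f.
  have -> : f = c *: delta 1 one.
    apply: l2_eq => k; rewrite l2Z /=; case: eqP => [->|/eqP/f0 ->].
      by apply/esym/mulr1.
    by rewrite scaler0.
  have rl : linear (right_shift g^-1) := (@reindex_bounded R G V _ (mulIg g^-1)).1.
  rewrite !(linZ _ _ rl) scaleNr !scalerA mulrC subrr //.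
by rewrite /= scaleNr.
Qed.

Definition left_commutant : set (K -> K) := commutant (left_shifts setT).
Definition left_algebra D : set (K -> K) := commutant (commutant (left_shifts D)).

Section Subgroup.
Variable D : set G.
Hypothesis D1 : D 1.
Hypothesis DM : forall g h, D g -> D h -> D (g * h).
Hypothesis DV : forall g, D g -> D g^-1.
Hypothesis Dinf : infinite_conjugates D.

Lemma infinite_conjugatesT : infinite_conjugates setT.
Proof. by move=> g /Dinf[u [_ uI]]; exists u. Qed.

Lemma left_commutant_factor : vn_factor left_commutant.
Proof.
have Lb := @left_shifts_bounded setT.
split; first exact: von_neumann_commutant Lb (left_shifts_adjoint_closed _).
rewrite eqEsubset; split => [T [TL TLL]|T Ts].
  apply: (shift_commutant_scalar infinite_conjugatesT TL) => g f.
  exact: (commutantE _ TLL (right_shift_commutant _ _)).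
split; first exact: scalar_commutant Ts.
by apply: scalar_commutant Ts; apply: commutant_bounded.
Qed.

Lemma left_algebra_factor : vn_factor (left_algebra D).
Proof.
have Lb := @left_shifts_bounded D.
have [_ _ _ _ _ Ladj] := commutant_star Lb (left_shifts_adjoint_closed DV).
split; first exact: von_neumann_commutant (@commutant_bounded _ _ _) Ladj.
rewrite eqEsubset; split => [T [TL]|T Ts].
  rewrite /left_algebra commutant3// => TD.
  apply: (shift_commutant_scalar Dinf TD) => g f.
  exact: (commutantE _ TL (right_shift_commutant _ _)).
split; first by apply: scalar_commutant Ts; apply: commutant_bounded.
by apply: scalar_commutant Ts; apply: commutant_bounded.
Qed.

Lemma left_commuting : commuting_operators left_commutant (left_algebra D).
Proof.
move=> a b aL [_ bL]; rewrite bL//; apply: commutant_anti aL.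
by move=> _ [g _ ->]; exists g.
Qed.

Lemma left_local_tomography : local_tomography left_commutant (left_algebra D).
Proof.
have [[sA _] _] := left_commutant_factor.
have [[sB _] _] := left_algebra_factor.
apply: irreducible_local_tomography => //; first exact: left_commuting.
move=> T TS; apply: (shift_commutant_scalar Dinf) => [|g f].
  rewrite -(commutant3 (@left_shifts_bounded D)).
  by apply: commutant_anti TS; apply: subsetUr.
apply: (commutantE _ TS); left; exact: right_shift_commutant.
Qed.

(* The left shift by g lies in left_commutant' but does not commute with the
   projection onto l2 (D), which lies in left_algebra D'. *)
Lemma left_not_haag g : ~ D g -> ~ haag_duality left_commutant (left_algebra D).
Proof.
move=> Dg hd.
have gL : left_algebra D (left_shift g).
  rewrite hd; apply: sub_commutant2; first exact: left_shifts_bounded.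
  by exists g.
have PD : commutant (left_shifts D) (restrict (V := V) D).
  apply: commutantI; first exact: restrict_bounded.
  move=> _ f [h Dh ->]; apply: l2_eq => k /=.
  congr (if _ then _ else _); apply/asboolP/asboolP => [Dk|Dk].
    by apply: DM => //; apply: DV.
  by rewrite -[k](mulVKg h); apply: DM.
pose one : V := (1%R : R[i]).
(* At delta_1, shifting after projecting gives delta_g, but projecting after shifting gives 0; the
   values at g differ. *)
have := commutantE (delta 1 one) gL PD.
move=> /(congr1 (fun f => l2val f g)) /=.
rewrite mulVg eqxx asboolT// asboolF// => /eqP.
by rewrite oner_eq0.
Qed.

End Subgroup.
End GroupFactors.

(** * The affine group over powers of two and its subgroup of even exponents *)

Section AffineGroup.
Variable R : realType.

(* The affine maps x |-> 2^n x + b of R. *)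
Definition affine : Type := (int * R)%type.

HB.instance Definition _ := Choice.on affine.

Definition affine_mul (p q : affine) : affine := (p.1 + q.1, p.2 + 2 ^ p.1 * q.2).
Definition affine_one : affine := (0, 0).
Definition affine_inv (p : affine) : affine := (- p.1, - (2 ^ (- p.1) * p.2)).

Lemma affine_mulA : associative affine_mul.
Proof.
move=> [n b] [m c] [l d]; rewrite /affine_mul /= addrA mulrDr addrA mulrA.
by rewrite expfzDr ?pnatr_eq0.
Qed.

Lemma affine_mul1 : left_id affine_one affine_mul.
Proof. by move=> [n b]; rewrite /affine_mul /= !add0r expr0z mul1r. Qed.

Lemma affine_1mul : right_id affine_one affine_mul.
Proof. by move=> [n b]; rewrite /affine_mul /= mulr0 !addr0. Qed.

Lemma affine_mulV : left_inverse affine_one affine_inv affine_mul.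
Proof. by move=> [n b]; rewrite /affine_mul /affine_inv /= !addNr. Qed.

Lemma affine_Vmul : right_inverse affine_one affine_inv affine_mul.
Proof.
move=> [n b]; rewrite /affine_mul /affine_inv /= subrr mulrN mulrA.
by rewrite -expfzDr ?pnatr_eq0// subrr expr0z mul1r subrr.
Qed.

HB.instance Definition _ := isGroup.Build affine affine_mulA affine_mul1 affine_1mul
  affine_mulV affine_Vmul.

Definition even_affine : set affine := [set p | exists m : int, p.1 = m + m].

Lemma even_affine_infinite_conjugates : infinite_conjugates even_affine.
Proof.
have two0 : 2 != 0 :> R by rewrite pnatr_eq0.
have two_inj : injective (fun n : int => (2 : R) ^ n).
  by apply: ieexprIz; rewrite ?pnatr_eq1.
move=> [m b] mb; have [m0|m0] := eqVneq m 0.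
  have b0 : b != 0 by apply: contra_neq mb => ->; rewrite m0.
  (* A translation by b becomes the translation by 2^(2n) b. *)
  exists (fun n : nat => (- (n%:Z + n%:Z), 0) : affine); split.
    by move=> n; exists (- n%:Z); rewrite opprD.
  move=> n n' /(congr1 snd) /=.
  rewrite m0 !mulr0 !addr0 !oppr0 !add0r !opprK => /(mulIf b0)/two_inj; lia.
(* Conjugating by the translation by n adds (2^m - 1) n to b, and 2^m <> 1 because m <> 0. *)
exists (fun n : nat => (0, n%:R) : affine); split.
  by move=> n; exists 0; rewrite addr0.
move=> n n' /(congr1 snd) /=.
rewrite oppr0 expr0z !mul1r add0r => h.
have {h} : (2 ^ m - 1) * n%:R = (2 ^ m - 1) * n'%:R :> R.
  by move: h; lra.
move=> /mulfI; rewrite subr_eq0 => h.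
apply/eqP; rewrite -(eqr_nat R); apply/eqP/h.
by apply: contra_neq m0 => e; apply: two_inj; rewrite e expr0z.
Qed.

End AffineGroup.

Theorem mainTheorem2 (R : realType) :
  (forall (H : hilbertType R) (MA MB : set (H -> H)),
     vn_factor MA -> vn_factor MB -> commuting_operators MA MB ->
     (haag_duality MA MB <-> uhlmann_property MA MB) /\
     (haag_duality MA MB -> local_tomography MA MB)) /\
  (exists (H : hilbertType R) (MA MB : set (H -> H)),
     vn_factor MA /\ vn_factor MB /\ commuting_operators MA MB /\
     local_tomography MA MB /\
     ~ haag_duality MA MB /\ ~ uhlmann_property MA MB).
Proof.
split=> [H MA MB FA FB AB|].
  split; last exact: haag_local_tomography.
  by split; [apply: haag_uhlmann FA.1 | apply: uhlmann_haag FA.1 FB.1 AB].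
pose D := @even_affine R.
have D1 : D 1%g by exists 0; rewrite addr0.
have DM g h : D g -> D h -> D (g * h)%g.
  by move=> [m gm] [n hn]; exists (m + n); rewrite /= gm hn addrACA.
have DV g : D g -> D (g^-1)%g.
  by move=> [m gm]; exists (- m); rewrite /= gm opprD.
have Dinf := @even_affine_infinite_conjugates R.
have Dg : ~ D ((1 : int), 0 : R) by move=> [m /=]; lia.
have FA := @left_commutant_factor R _ D Dinf.
have FB := @left_algebra_factor R _ D DV Dinf.
have AB := @left_commuting R _ D.
have NH := @left_not_haag R _ D D1 DM DV _ Dg.
exists (l2_hilbert (affine R) (scalar_hilbert R)), (@left_commutant R (affine R)),
  (left_algebra D); split => //; split => //; split => //; split; last first.
  (* The Uhlmann property would give Haag duality by part (i). *)
  by split => //; apply: contra_not NH; apply: uhlmann_haag FA.1 FB.1 AB.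
exact: left_local_tomography.
Qed.
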